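(* Let $r\ge1$ and $U=(\mathbb{C}^* )^r$. Composing the restriction map of vector fields from $\mathbb{P}^r$ to $\mathbb{G}_m^r=\mathbb{P}^r\setminus\{Z_0Z_1\cdots Z_r=0\}$ with the isomorphism $\mathrm{Vect}(\mathbb{G}_m^r)\cong SH^1(U)$, $z^n\cdot z_i\partial_i\leftrightarrow z^n\theta_i$, gives an embedding of Lie algebras $\mathfrak{sl}_{r+1}(\mathbb{K})\to SH^1(U)$. Its image consists of those elements of $SH^1(U)$ that correspond to vector fields on $\mathbb{G}_m^r$ that extend to $\mathbb{P}^r$. The Cartan subalgebra $\mathfrak{h}$ of $\mathfrak{sl}_{r+1}(\mathbb K)$ spanned by the classes of the $Z_iD_i$ is mapped onto $\langle\theta_1,\dots,\theta_r\rangle$, which is the image of the canonical map $H^1(U)\to SH^1(U)$. With respect to the grading of $SH^1(U)$ by $H_1(U;\mathbb{Z})$, the subalgebra $\mathfrak{h}$ lies in degree $0$, and the image of the class of $Z_iD_j$, $i\ne j$, is homogeneous of degree $e_i-e_j$, so that the non-zero degrees occurring form the $A_r$ root system $\{e_a-e_b\mid a\neq b,\ a,b\in\{0,\dots,r\}\}$.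
   Context: $\mathbb{K}$ is a field of characteristic zero. On $\mathbb{P}^r$ with homogeneous coordinates $Z_0,\dots,Z_r$ and $D_i=\partial/\partial Z_i$, the Lie algebra of global vector fields is $\langle Z_iD_j\mid 0\le i,j\le r\rangle/\langle\sum_iZ_iD_i\rangle\cong\mathfrak{gl}_{r+1}/\text{scalars}\cong\mathfrak{sl}_{r+1}(\mathbb{K})$. Affine coordinates are $z_i=Z_i/Z_0$, $\partial_i=\partial/\partial z_i$, $1\le i\le r$. $SH^*(U)$ is symplectic cohomology of $U$ (with $U\cong T^*T^r$ as a Liouville manifold), a Batalin--Vilkovisky algebra: $SH^*(U)\cong\mathbb{K}[z_1^{\pm1},\dots,z_r^{\pm1}]\otimes\Lambda^*[\theta_1,\dots,\theta_r]=\mathbb{K}[H_1(T^r;\mathbb{Z})]\otimes H^*(T^r;\mathbb{K})$, where $\theta_1,\dots,\theta_r$ is an integral basis of $H^1(T^r;\mathbb{Z})$ and $z_1,\dots,z_r$ the dual basis of $H_1(T^r;\mathbb{Z})$; $z^n=z_1^{n_1}\cdots z_r^{n_r}$. The Lie bracket on $SH^1(U)$ is $[x,y]=\Delta(xy)-\Delta(x)y+x\Delta(y)$. The grading by $H_1(U;\mathbb{Z})\cong H_1(T^r;\mathbb{Z})$ is by homology class of periodic orbits; $z^n\theta_i$ has degree $n$. Identify $U$ with $\{X_0X_1\cdots X_r=1\}\subset(\mathbb{C}^* )^{r+1}$ via $x_i=X_i$, $i\ge1$; then $H_1(U;\mathbb{Z})$ embeds in $H_1((\mathbb{C}^* )^{r+1};\mathbb{Z})=\mathbb{Z}^{r+1}$,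 with basis $e_0,\dots,e_r$ corresponding to the coordinates given by integration of $(2\pi i)^{-1}X_i^{-1}dX_i$, as the sublattice of vectors with coordinate sum zero (the $A_r$ root lattice), and the class $z_i$ is sent to $e_i-e_0$. *)

(* Defs.v *)
From HB Require Import structures.
From mathcomp Require Import all_boot all_order all_algebra.
From mathcomp Require Import finmap.
From mathcomp.multinomials Require Import monalg.
Set Implicit Arguments.
Unset Strict Implicit.
Unset Printing Implicit Defensive.
Import GRing.Theory.
Local Open Scope ring_scope.

(* {malg K[B]} is the free K-module on the set B.  Its ring structure in the
   library requires a conical monoid of monomials, hence excludes Laurent
   monomials; products on it are therefore defined here from their values on
   basis elements, by K-linear extension. *)

Definition linext (K : fieldType) (B : choiceType) (V : lmodType K)
    (f : B -> V) (x : {malg K[B]}) : V :=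
  \sum_(b <- msupp x) x@_b *: f b.

Section LinearExtension.
Context {K : fieldType} {B : choiceType}.
Implicit Types (x y : {malg K[B]}) (V : lmodType K).

Lemma linextEw V (f : B -> V) x (d : {fset B}) :
  (msupp x `<=` d)%fset -> linext f x = \sum_(b <- d) x@_b *: f b.
Proof.
move=> le_xd; rewrite /linext (big_fset_incl _ le_xd) // => b _ /mcoeff_outdom ->.
by rewrite scale0r.
Qed.

Lemma linext_is_linear V (f : B -> V) : linear (linext f).
Proof.
move=> a x y; pose d := (msupp x `|` msupp y)%fset.
have le_d : (msupp (a *: x + y) `<=` d)%fset.
  apply: fsubset_trans (msuppD_le _ _) _.
  exact: fsetSU (msuppZ_le _ _).
rewrite (linextEw _ le_d) (linextEw f (fsubsetUl (msupp x) (msupp y))).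
rewrite (linextEw f (fsubsetUr (msupp x) (msupp y))) scaler_sumr -big_split.
by apply: eq_bigr => b _; rewrite /= mcoeffD mcoeffZ scalerDl scalerA.
Qed.

HB.instance Definition _ V (f : B -> V) :=
  GRing.isLinear.Build K {malg K[B]} V _ (linext f) (linext_is_linear f).

Lemma linextU V (f : B -> V) b : linext f << b >> = f b.
Proof.
by rewrite (linextEw _ msuppU_le) big_seq_fset1 mcoeffUU scale1r.
Qed.

Lemma malg_basisE x : x = \sum_(b <- msupp x) x@_b *: << b >>.
Proof.
rewrite {1}[x]monalgE; apply: eq_bigr => b _; apply/malgP => c.
by rewrite mcoeffZ !mcoeffU mulrnAr mulr1.
Qed.

(* two linear maps that agree on the basis are equal *)
Lemma linear_malg_ext V (f g : {malg K[B]} -> V) :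
  linear f -> linear g -> (forall b, f << b >> = g << b >>) -> f =1 g.
Proof.
move=> lf lg fg x.
pose F := GRing.isLinear.Build K {malg K[B]} V _ f lf.
pose G := GRing.isLinear.Build K {malg K[B]} V _ g lg.
pose f' : {linear _ -> _} := HB.pack f F.
pose g' : {linear _ -> _} := HB.pack g G.
rewrite -[f x]/(f' x) -[g x]/(g' x) [x]malg_basisE !linear_sum.
by apply: eq_bigr => b _; rewrite !linearZ; congr (_ *: _); exact: fg.
Qed.

End LinearExtension.

Section BilinearProduct.
Context {K : fieldType} {B : choiceType}.
Variables (u : B) (mu : B -> B -> {malg K[B]}).

Definition bilext (x y : {malg K[B]}) : {malg K[B]} :=
  linext (fun a => linext (mu a) y) x.

Lemma bilextU a b : bilext << a >> << b >> = mu a b.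
Proof. by rewrite /bilext !linextU. Qed.

Lemma bilextPl c x x' y : bilext (c *: x + x') y = c *: bilext x y + bilext x' y.
Proof. exact: linearP. Qed.

Lemma bilextPr c x y y' : bilext x (c *: y + y') = c *: bilext x y + bilext x y'.
Proof.
rewrite /bilext /linext scaler_sumr -big_split.
apply: eq_bigr => a _ /=; rewrite -!/(linext _ _) linearP scalerDr !scalerA.
by rewrite mulrC.
Qed.

Lemma bilextDl : left_distributive bilext +%R.
Proof. by move=> x x' y; have := bilextPl 1 x x' y; rewrite !scale1r. Qed.

Lemma bilextDr : right_distributive bilext +%R.
Proof. by move=> x y y'; have := bilextPr 1 x y y'; rewrite !scale1r. Qed.

Lemma bilextZl c x y : c *: bilext x y = bilext (c *: x) y.
Proof. by rewrite /bilext linearZ. Qed.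

Lemma bilext0r x : bilext x 0 = 0.
Proof. by apply: (addrI (bilext x 0)); rewrite -bilextDr !addr0. Qed.

Lemma bilextZr c x y : c *: bilext x y = bilext x (c *: y).
Proof. by rewrite -[c *: y]addr0 bilextPr bilext0r addr0. Qed.

Lemma bilext1l : (forall b, mu u b = << b >>) -> left_id << u >> bilext.
Proof.
move=> mu1; apply: linear_malg_ext => [c x y|c x y|b] //=.
  by rewrite bilextPr.
by rewrite bilextU.
Qed.

Lemma bilext1r : (forall b, mu b u = << b >>) -> right_id << u >> bilext.
Proof.
move=> mu1; apply: linear_malg_ext => [c x y|c x y|b] //=.
  by rewrite bilextPl.
by rewrite bilextU.
Qed.

Lemma bilextA :
  (forall a b c, bilext << a >> (mu b c) = bilext (mu a b) << c >>) ->
  associative bilext.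
Proof.
move=> muA x y z; move: x.
apply: linear_malg_ext => [c x x'|c x x'|a]; rewrite ?bilextPl //.
move: y; apply: linear_malg_ext => [c x x'|c x x'|b].
- by rewrite bilextPl bilextPr.
- by rewrite bilextPr bilextPl.
move: z; apply: linear_malg_ext => [c x x'|c x x'|d].
- by rewrite !bilextPr.
- by rewrite bilextPr.
by rewrite !bilextU muA.
Qed.

Lemma bilextC :
  (forall a b, mu a b = mu b a) -> commutative bilext.
Proof.
move=> muC x y; move: x.
apply: linear_malg_ext => [c x x'|c x x'|a]; rewrite ?bilextPl ?bilextPr //.
move: y; apply: linear_malg_ext => [c x x'|c x x'|b].
- by rewrite bilextPr.
- by rewrite bilextPl.
by rewrite !bilextU.
Qed.

End BilinearProduct.

Lemma malgU_neq0 (K : fieldType) (B : choiceType) (b : B) :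
  << b >> != 0 :> {malg K[B]}.
Proof. by rewrite monalgU_eq0 oner_neq0. Qed.

(* ------------------------------------------------------------------------ *)

Definition laurent (K : fieldType) (n : nat) := {malg K['rV[int]_n]}.

Section Laurent.
Variables (K : fieldType) (n : nat).

HB.instance Definition _ := GRing.Lmodule.on (laurent K n).

Definition lmon (m : 'rV[int]_n) : laurent K n := << m >>.

Definition laurent_mul : laurent K n -> laurent K n -> laurent K n :=
  bilext (fun m m' => lmon (m + m')).

Lemma laurent_mulA : associative laurent_mul.
Proof. by apply: bilextA => a b c; rewrite !bilextU addrA. Qed.

Lemma laurent_mulC : commutative laurent_mul.
Proof. by apply: bilextC => a b; rewrite addrC. Qed.

Lemma laurent_mul1 : left_id (lmon 0) laurent_mul.
Proof. by apply: bilext1l => a; rewrite add0r. Qed.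

Lemma laurent_mulDl : left_distributive laurent_mul +%R.
Proof. exact: bilextDl. Qed.

HB.instance Definition _ := GRing.Zmodule_isComNzRing.Build (laurent K n)
  laurent_mulA laurent_mulC laurent_mul1 laurent_mulDl (malgU_neq0 K 0).

HB.instance Definition _ := GRing.Lmodule_isLalgebra.Build K (laurent K n)
  (fun c x y => bilextZl _ c x y).

HB.instance Definition _ := GRing.Lalgebra_isComAlgebra.Build K (laurent K n).

Definition expo (i : 'I_n) : 'rV[int]_n := delta_mx 0 i.

Definition lvar (i : 'I_n) : laurent K n := lmon (expo i).
Definition lvarV (i : 'I_n) : laurent K n := lmon (- expo i).

Definition lpartial (i : 'I_n) : laurent K n -> laurent K n :=
  linext (fun m : 'rV[int]_n => (m 0 i)%:~R *: lmon (m - expo i)).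

(* vector fields on Spec of the Laurent polynomial ring *)
Definition derivation (D : laurent K n -> laurent K n) : Prop :=
  linear D /\ forall f g, D (f * g) = D f * g + f * D g.

Definition vf_bracket (D E : laurent K n -> laurent K n) :=
  fun f => D (E f) - E (D f).

End Laurent.

Arguments expo {n} i.
Arguments lmon {K n} m.
Arguments lvar {K n} i.
Arguments lvarV {K n} i.

(* ------------------------------------------------------------------------ *)

Section Torus.
Variables (K : fieldType) (r : nat).

(* The inclusion Z^r -> Z^(r+1) with z_i |-> e_i - e_0.  It is the embedding of
   H_1(U; Z) as the sublattice of coordinate sum zero, and also the substitution
   z_i = Z_i / Z_0 on exponents. *)
Definition root_embed (n : 'rV[int]_r) : 'rV[int]_r.+1 :=
  \sum_(i < r) n 0 i *: (expo (lift ord0 i) - expo ord0).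

(* O(G_m^r) is identified with the degree-zero part of K[Z_0^{+-1},...,Z_r^{+-1}];
   dehomogenize sets Z_0 = 1, and is inverse to homogenize on that part. *)
Definition homogenize : laurent K r -> laurent K r.+1 :=
  linext (fun n => lmon (root_embed n)).

Definition dehomogenize : laurent K r.+1 -> laurent K r :=
  linext (fun m : 'rV[int]_r.+1 => lmon (\row_i m 0 (lift ord0 i))).

(* restriction to G_m^r of the vector field \sum A_ij Z_i D_j on P^r *)
Definition restrict_vf (A : 'M[K]_r.+1) (f : laurent K r) : laurent K r :=
  dehomogenize
    (\sum_(i < r.+1) \sum_(j < r.+1)
       A i j *: (lvar i * lpartial j (homogenize f))).

(* f lies in K[Z_0/Z_k, ..., Z_r/Z_k], the ring of functions on the chart
   {Z_k != 0} of P^r *)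
Definition regular_on_chart (k : 'I_r.+1) (f : laurent K r) : Prop :=
  forall n, n \in msupp f -> forall j, j != k -> (0 <= root_embed n 0 j)%R.

(* D restricts to a derivation of the coordinate ring of each standard affine
   chart; these restrictions agree on overlaps since they agree on G_m^r. *)
Definition extends_to_P (D : laurent K r -> laurent K r) : Prop :=
  forall k f, regular_on_chart k f -> regular_on_chart k (D f).

End Torus.

(* ------------------------------------------------------------------------ *)

(* SH^*(U) = K[H_1(T^r; Z)] (x) H^*(T^r; K): the basis element (n, I) stands for
   z^n theta_I, with theta_I the product of the theta_i for i in I, in increasing
   order. *)
Definition SH (K : fieldType) (r : nat) := {malg K[('rV[int]_r * {set 'I_r})%type]}.

Section SymplecticCohomology.
Variables (K : fieldType) (r : nat).

HB.instance Definition _ := GRing.Lmodule.on (SH K r).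

Definition shmon (n : 'rV[int]_r) (I : {set 'I_r}) : SH K r := << (n, I) >>.

Definition inversions (I J : {set 'I_r}) : nat :=
  #|[set p : 'I_r * 'I_r | [&& p.1 \in I, p.2 \in J & (p.2 < p.1)%N]]|.

Definition sh_mulU (a b : 'rV[int]_r * {set 'I_r}) : SH K r :=
  if [disjoint a.2 & b.2]
  then (-1) ^+ inversions a.2 b.2 *: shmon (a.1 + b.1) (a.2 :|: b.2)
  else 0.

Definition sh_mul : SH K r -> SH K r -> SH K r := bilext sh_mulU.

Lemma inversionsUl (I J L : {set 'I_r}) : [disjoint I & J] ->
  inversions (I :|: J) L = (inversions I L + inversions J L)%N.
Proof.
move=> dIJ; rewrite /inversions -cardsUI.
rewrite [X in (_ + #|pred_of_set X|)%N](_ : _ = set0) ?cards0 ?addn0.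
  by apply: eq_card => p; rewrite !inE andb_orl.
apply/setP => p; rewrite !inE; apply/negP => /andP[/and3P[pI _ _] /and3P[pJ _ _]].
by have := disjointFr dIJ pI; rewrite pJ.
Qed.

Lemma inversionsUr (I J L : {set 'I_r}) : [disjoint J & L] ->
  inversions I (J :|: L) = (inversions I J + inversions I L)%N.
Proof.
move=> dJL; rewrite /inversions -cardsUI.
rewrite [X in (_ + #|pred_of_set X|)%N](_ : _ = set0) ?cards0 ?addn0.
  by apply: eq_card => p; rewrite !inE andb_orl andb_orr.
apply/setP => p; rewrite !inE; apply/negP => /andP[/and3P[_ pJ _] /and3P[_ pL _]].
by have := disjointFr dJL pJ; rewrite pL.
Qed.

Lemma inversions0l (I : {set 'I_r}) : inversions set0 I = 0%N.
Proof. by apply: eq_card0 => p; rewrite !inE. Qed.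

Lemma inversions0r (I : {set 'I_r}) : inversions I set0 = 0%N.
Proof. by apply: eq_card0 => p; rewrite !inE andbF. Qed.

Lemma disjointsUr (I J L : {set 'I_r}) :
  [disjoint I & J :|: L] = [disjoint I & J] && [disjoint I & L].
Proof. by rewrite !disjoints_subset setCU subsetI. Qed.

Lemma disjointsUl (I J L : {set 'I_r}) :
  [disjoint I :|: J & L] = [disjoint I & L] && [disjoint J & L].
Proof. by rewrite !(disjoint_sym _ L) disjointsUr. Qed.

Lemma sh_mulA : associative sh_mul.
Proof.
apply: bilextA => -[a I] [b J] [c L].
have ZU k n M m N : bilext sh_mulU (k *: shmon n M) (shmon m N)
    = k *: sh_mulU (n, M) (m, N).
  by rewrite -bilextZl bilextU.
have UZ k n M m N : bilext sh_mulU (shmon m N) (k *: shmon n M)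
    = k *: sh_mulU (m, N) (n, M).
  by rewrite -bilextZr bilextU.
rewrite -[<< (a, I) >>]/(shmon a I) -[<< (c, L) >>]/(shmon c L).
have U0 m N : bilext sh_mulU 0 (shmon m N) = 0 by rewrite /bilext linear0.
rewrite {2}/sh_mulU {3}/sh_mulU /=.
have [dJL|nJL] := boolP [disjoint J & L]; have [dIJ|nIJ] := boolP [disjoint I & J].
- rewrite ZU UZ /sh_mulU /= disjointsUr disjointsUl.
  rewrite dJL dIJ andbT /=.
  have [dIL|_] := boolP [disjoint I & L]; last by rewrite !scaler0.
  rewrite scalerA [RHS]scalerA -!exprD addrA setUA.
  by rewrite (inversionsUl L dIJ) (inversionsUr I dJL) addnC -addnA.
- by rewrite UZ U0 /sh_mulU /= disjointsUr (negPf nIJ) scaler0.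
- by rewrite ZU bilext0r /sh_mulU /= disjointsUl (negPf nJL) andbF scaler0.
- by rewrite bilext0r U0.
Qed.

Lemma sh_mul1l : left_id (shmon 0 set0) sh_mul.
Proof.
apply: bilext1l => -[b J].
by rewrite /sh_mulU /= disjoints_subset sub0set inversions0l scale1r add0r set0U.
Qed.

Lemma sh_mul1r : right_id (shmon 0 set0) sh_mul.
Proof.
apply: bilext1r => -[b J].
rewrite /sh_mulU /= disjoint_sym disjoints_subset sub0set inversions0r.
by rewrite scale1r addr0 setU0.
Qed.

Lemma sh_mulDl : left_distributive sh_mul +%R.
Proof. exact: bilextDl. Qed.

Lemma sh_mulDr : right_distributive sh_mul +%R.
Proof. exact: bilextDr. Qed.

HB.instance Definition _ := GRing.Zmodule_isNzRing.Build (SH K r)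
  sh_mulA sh_mul1l sh_mul1r sh_mulDl sh_mulDr (malgU_neq0 K (0, set0)).

HB.instance Definition _ := GRing.Lmodule_isLalgebra.Build K (SH K r)
  (fun c x y => bilextZl _ c x y).

HB.instance Definition _ := GRing.Lalgebra_isAlgebra.Build K (SH K r)
  (fun c x y => bilextZr _ c x y).

Definition theta (i : 'I_r) : SH K r := shmon 0 [set i].

(* The BV operator comes from loop rotation on H_*(LT^r): it is contraction of
   the exterior factor with the free homotopy class n. *)
Definition BV_Delta : SH K r -> SH K r :=
  linext (fun a : 'rV[int]_r * {set 'I_r} =>
    \sum_(i in a.2)
      ((-1) ^+ #|[set j in a.2 | (j < i)%N]| * (a.1 0 i)%:~R)
        *: shmon a.1 (a.2 :\ i)).

Definition sh_degree (k : nat) (x : SH K r) : Prop :=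
  forall a, a \in msupp x -> #|a.2| = k.

(* the bracket on SH^1; on elements of other degrees the signs would differ *)
Definition sh_bracket (x y : SH K r) : SH K r :=
  BV_Delta (x * y) - BV_Delta x * y + x * BV_Delta y.

(* x is homogeneous of degree d for the grading by H_1(U; Z), the latter being
   embedded in Z^(r+1) *)
Definition sh_homogeneous (d : 'rV[int]_r.+1) (x : SH K r) : Prop :=
  forall a, a \in msupp x -> root_embed a.1 = d.

(* H^*(U) = H^*(T^r; K) is the exterior algebra on theta_1, ..., theta_r; the
   canonical map H^*(U) -> SH^*(U) is given by constant loops. *)
Definition coh_degree (k : nat) (c : {malg K[{set 'I_r}]}) : Prop :=
  forall I, I \in msupp c -> #|I| = k.

Definition canonical_map : {malg K[{set 'I_r}]} -> SH K r :=
  linext (fun I => shmon 0 I).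

Definition laurent_to_SH : laurent K r -> SH K r :=
  linext (fun n => shmon n set0).

(* z^n z_i \partial_i |-> z^n theta_i: the coefficient of z_i \partial_i in a
   vector field D is z_i^{-1} D(z_i). *)
Definition sh_of_vf (D : laurent K r -> laurent K r) : SH K r :=
  \sum_(i < r) laurent_to_SH (lvarV i * D (lvar i)) * theta i.

(* the map induced on classes of matrices A = \sum A_ij Z_i D_j modulo scalars *)
Definition sl_to_SH (A : 'M[K]_r.+1) : SH K r := sh_of_vf (restrict_vf A).

End SymplecticCohomology.

(* ------------------------------------------------------------------------ *)

Section SpecialLinear.
Variables (K : fieldType) (n : nat).

Definition mx_bracket (A B : 'M[K]_n) : 'M[K]_n := A *m B - B *m A.

Definition in_sl (A : 'M[K]_n) : Prop := \tr A = 0.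

(* the traceless representative of the class of A in gl_n / scalars *)
Definition sl_class (A : 'M[K]_n) : 'M[K]_n := A - (\tr A / n%:R)%:M.

(* a nilpotent, self-normalizing Lie subalgebra of g *)
Definition cartan_subalgebra (g h : 'M[K]_n -> Prop) : Prop :=
  [/\ forall A, h A -> g A,
      h 0 /\ (forall (a : K) A B, h A -> h B -> h (a *: A + B)),
      forall A B, h A -> h B -> h (mx_bracket A B),
      exists N : nat, forall A (s : seq 'M[K]_n),
        h A -> (forall B, B \in s -> h B) -> size s = N ->
        foldl mx_bracket A s = 0
    & forall A, g A -> (forall B, h B -> h (mx_bracket A B)) -> h A].

(* the span of the classes of the Z_i D_i *)
Definition diag_classes (A : 'M[K]_n) : Prop :=
  exists c : 'rV[K]_n, A = \sum_(i < n) c 0 i *: sl_class (delta_mx i i).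

End SpecialLinear.

(* Main.v *)
(* A derivation D of a ring of Laurent polynomials is determined by its logarithmic
   derivatives z^-m D(z^m), which depend additively on m; so D amounts to arbitrary
   Laurent polynomials g_i = z_i^-1 D(z_i), and the isomorphism with SH^1 sends D to
   the sum of the g_i theta_i. A field on P^r is restricted by conjugating the
   derivation of K[Z_0^+-1, ..., Z_r^+-1] it defines by homogenization, and the
   bracket of such derivations can be tested on the Z_l, where it is the matrix
   bracket.

   For the image, write the coefficient of z^n in z^-m D(z^m), m = e_j - e_k, as
   h_n(j) - h_n(k). If D extends to the chart Z_k != 0 and this is non-zero, then
   n + e_j - e_k is non-negative away from k. When n != 0 and h_n is not constant,
   these conditions force n = e_a - e_b with h_n constant away from b, which is the
   field z^n Z_b D_b = Z_a D_b up to a scalar. *)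

Require Import Defs.
From HB Require Import structures.
From mathcomp Require Import all_boot all_order all_algebra.
From mathcomp Require Import finmap.
From mathcomp.multinomials Require Import monalg.
From mathcomp Require Import ring zify.
Set Implicit Arguments.
Unset Strict Implicit.
Unset Printing Implicit Defensive.
Import Order.TTheory GRing.Theory Num.Theory.
Local Open Scope ring_scope.

(** * Coefficients and supports of linear extensions *)

Section FreeModule.
Variables (K : fieldType) (B : choiceType).
Implicit Type x : {malg K[B]}.

Lemma mcoeff_linext (C : choiceType) (F : B -> {malg K[C]}) x c :
  (linext F x)@_c = \sum_(b <- msupp x) x@_b * (F b)@_c.
Proof. by rewrite /linext raddf_sum; apply: eq_bigr => b _; rewrite /= mcoeffZ. Qed.

Lemma msupp_linext (C : choiceType) (F : B -> {malg K[C]}) x c :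
  c \in msupp (linext F x) -> exists2 b, b \in msupp x & c \in msupp (F b).
Proof.
rewrite -mcoeff_neq0 mcoeff_linext => nz.
have /hasP[b bx nb] : has (fun b => x@_b * (F b)@_c != 0) (msupp x).
  apply: contraNT nz => /hasPn h; rewrite big_seq big1 // => b /h.
  by rewrite negbK => /eqP.
exists b => //; rewrite -mcoeff_neq0; apply: contraNneq nb => ->.
by rewrite mulr0.
Qed.

Lemma mcoeff_linext_inj (C : choiceType) (h : B -> C) x b : injective h ->
  (linext (fun a => << h a >> : {malg K[C]}) x)@_(h b) = x@_b.
Proof.
move=> h_inj; rewrite mcoeff_linext [in RHS](malg_basisE x) raddf_sum.
by apply: eq_bigr => a _; rewrite /= mcoeffZ !mcoeffU (inj_eq h_inj).
Qed.

Lemma mcoeff_linext_out (C : choiceType) (h : B -> C) x c :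
  (forall a, h a != c) -> (linext (fun a => << h a >> : {malg K[C]}) x)@_c = 0.
Proof.
move=> hc; rewrite mcoeff_linext big1 // => a _.
by rewrite mcoeffU (negPf (hc a)) mulr0.
Qed.

Lemma msupp_scale c x b : b \in msupp (c *: x) -> b \in msupp x.
Proof. by rewrite -!mcoeff_neq0 mcoeffZ mulf_eq0 negb_or => /andP[]. Qed.

Lemma msupp_sum (I : Type) (s : seq I) (P : pred I) (F : I -> {malg K[B]}) b :
  b \in msupp (\sum_(i <- s | P i) F i) -> exists2 i, P i & b \in msupp (F i).
Proof.
elim/big_rec: _ => [|i x Pi IH]; first by rewrite msupp0.
rewrite -mcoeff_neq0 mcoeffD => nz.
have [Fi0|Fin] := eqVneq (F i)@_b 0.
  by apply: IH; rewrite -mcoeff_neq0; move: nz; rewrite Fi0 add0r.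
by exists i; rewrite -?mcoeff_neq0.
Qed.

End FreeModule.

(** * Derivations and Laurent monomials *)

(* Rewriting with ring laws directly in [laurent K n] makes the conversion test
   unfold the multiplication of that type; the algebra is therefore done in an
   arbitrary commutative algebra. *)
Section Derivations.
Variables (K : fieldType) (A : comAlgType K).
Implicit Types (f g : A) (D E : A -> A).

Definition is_derivation D := linear D /\ forall f g, D (f * g) = D f * g + f * D g.

Lemma vfD D f g : is_derivation D -> D (f + g) = D f + D g.
Proof. by move=> derD; rewrite -[f]scale1r derD.1 !scale1r. Qed.

Lemma vf0 D : is_derivation D -> D 0 = 0.
Proof. by move=> derD; apply: (addrI (D 0)); rewrite -vfD // !addr0. Qed.

Lemma vfZ D c f : is_derivation D -> D (c *: f) = c *: D f.
Proof. by move=> derD; rewrite -[c *: f]addr0 derD.1 vf0 // addr0. Qed.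

Lemma vf1 D : is_derivation D -> D 1 = 0.
Proof.
by case=> _ DM; apply: (addrI (D 1)); rewrite -{3}[1]mulr1 DM mulr1 mul1r addr0.
Qed.

Lemma vf_sum D (I : Type) (s : seq I) (P : pred I) F : is_derivation D ->
  D (\sum_(i <- s | P i) F i) = \sum_(i <- s | P i) D (F i).
Proof. by move=> derD; apply: (big_morph D) => [x y|]; rewrite ?vfD ?vf0. Qed.

(** Differentiating [g * f = 1] gives [D g * f + g * D f = 0]; multiply by [g]. *)
Lemma vf_inverse D f g : is_derivation D -> g * f = 1 -> D g = - (g * g * D f).
Proof.
move=> derD gf1; have := vf1 derD; rewrite -gf1 derD.2 => /(congr1 ( *%R^~ g)).
rewrite mul0r mulrDl -mulrA [f * g]mulrC gf1 mulr1 => /eqP.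
by rewrite addr_eq0 => /eqP->; rewrite mulrAC.
Qed.

Lemma is_derivation_mulr f D : is_derivation D -> is_derivation (fun g => f * D g).
Proof.
case=> lD DM; split=> [c x y|x y]; first by rewrite lD mulrDr -scalerAr.
by rewrite DM mulrDr mulrA [f * (x * _)]mulrCA.
Qed.

Lemma is_derivation_sum (I : Type) (s : seq I) (P : pred I) (D : I -> A -> A) :
  (forall i, P i -> is_derivation (D i)) ->
  is_derivation (fun f => \sum_(i <- s | P i) D i f).
Proof.
move=> derD; split=> [c x y|x y].
  by rewrite scaler_sumr -big_split; apply: eq_bigr => i Pi; apply: (derD i Pi).1.
by rewrite mulr_suml mulr_sumr -big_split; apply: eq_bigr => i Pi; apply: (derD i Pi).2.
Qed.

Lemma is_derivation_scale c D : is_derivation D -> is_derivation (fun f => c *: D f).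
Proof.
move=> [lD DM]; split=> [d x y|x y].
  by rewrite lD scalerDr !scalerA mulrC.
by rewrite DM scalerDr scalerAl scalerAr.
Qed.

Lemma is_derivation_bracket D E : is_derivation D -> is_derivation E ->
  is_derivation (fun f => D (E f) - E (D f)).
Proof.
move=> derD derE; have [[lD DM] [lE EM]] := (derD, derE); split=> [c x y|x y].
  by rewrite lE !lD lE scalerBr opprD addrACA.
by rewrite EM DM !(vfD _ _ derD) !(vfD _ _ derE) !DM !EM; ring.
Qed.

(** The Leibniz terms in which [w] is differentiated are [- (w * w * D z) * E z] and its mirror
    image under exchange of [D] and [E]; commutativity makes them equal and they cancel. The
    components of a bracket can thus be computed from those of [D] and [E]. *)
Lemma bracket_log_deriv D E z w : is_derivation D -> is_derivation E -> w * z = 1 ->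
  w * (D (E z) - E (D z)) = D (w * E z) - E (w * D z).
Proof.
move=> derD derE wz; rewrite derD.2 derE.2 (vf_inverse derD wz) (vf_inverse derE wz).
ring.
Qed.

Lemma inverse_mul_inj (f g x y : A) : g * f = 1 -> g * x = g * y -> x = y.
Proof.
by move=> gf1 /(congr1 ( *%R f)); rewrite !mulrA [f * g]mulrC gf1 !mul1r.
Qed.

End Derivations.

(** * Logarithmic derivatives in an algebra spanned by Laurent monomials *)

Section MonomialAlgebra.
Variables (K : fieldType) (n : nat) (A : comAlgType K) (mon : 'rV[int]_n -> A).
Hypotheses (mon0 : mon 0 = 1) (monD : forall a b, mon (a + b) = mon a * mon b).
Hypothesis mon_ext : forall (V : lmodType K) (F G : A -> V),
  linear F -> linear G -> (forall m, F (mon m) = G (mon m)) -> F =1 G.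
Implicit Types (m : 'rV[int]_n) (f g : A) (D E : A -> A).

Lemma monNK m : mon (- m) * mon m = 1.
Proof. by rewrite -monD addNr. Qed.

Definition logder D m : A := mon (- m) * D (mon m).

(** The Leibniz rule for [mon m * mon m'], divided by that monomial. *)
Lemma logderD D m m' : is_derivation D ->
  logder D (m + m') = logder D m + logder D m'.
Proof.
case=> _ DM; rewrite /logder monD DM opprD monD.
rewrite mulrDr [X in X + _]mulrACA [X in _ + X]mulrACA !monNK.
by rewrite mulr1 mul1r.
Qed.

Lemma logderB D m m' : is_derivation D ->
  logder D (m - m') = logder D m - logder D m'.
Proof. by move=> derD; apply/eqP; rewrite eq_sym subr_eq -logderD // subrK. Qed.

Lemma logderMz D m (k : int) : is_derivation D ->
  logder D (k *: m) = k%:~R *: logder D m.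
Proof.
move=> derD; have DB : zmod_morphism (logder D) by move=> x y; apply: logderB.
pose L := GRing.isZmodMorphism.Build _ _ (logder D) DB.
pose D' : {additive 'rV[int]_n -> A} := HB.pack (logder D) L.
by rewrite scaler_int -(raddfMz D') -scaler_int intz.
Qed.

Lemma mon_logder D m : mon m * logder D m = D (mon m).
Proof. by rewrite mulrA [mon m * _]mulrC monNK mul1r. Qed.

Lemma logder_sum D m : is_derivation D ->
  logder D m = \sum_i (m 0 i)%:~R *: logder D (expo i).
Proof.
move=> derD; rewrite {1}(row_sum_delta m).
have D0 : logder D 0 = 0 by rewrite -(subrr 0) logderB // subrr.
rewrite (big_morph (logder D) (fun x y => logderD x y derD) D0).
by apply: eq_bigr => i _; rewrite logderMz.
Qed.

(** [D (mon m)] is recovered from [logder D m], which by additivity is an integer combination of the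
    values at the unit vectors; [mon_ext] passes from monomials to all of [A]. *)
Lemma is_derivation_ext D E : is_derivation D -> is_derivation E ->
  (forall i, D (mon (expo i)) = E (mon (expo i))) -> D =1 E.
Proof.
move=> derD derE DE; apply: mon_ext; first by [case: derD]; first by [case: derE].
move=> m; rewrite -!mon_logder !logder_sum //.
by congr (_ * _); apply: eq_bigr => i _; rewrite /logder DE.
Qed.

Lemma expoE i j : @expo n i 0 j = (i == j)%:R.
Proof. by rewrite mxE eqxx eq_sym. Qed.

Variable i : 'I_n.
Variable P : A -> A.
Hypotheses (linP : linear P) (PU : forall m, P (mon m) = (m 0 i)%:~R *: mon (m - expo i)).

(** The Leibniz identity is linear in each factor, so monomials suffice; there it expresses
    additivity of the exponent at [i]. *)
Lemma is_derivation_partial : is_derivation P.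
Proof.
pose L := GRing.isLinear.Build K A A _ P linP.
pose P' : {linear A -> A} := HB.pack P L.
have lP c x y : P (c *: x + y) = c *: P x + P y by apply: linP.
split=> // f g; move: f; apply: mon_ext => [c x y|c x y|m].
- by rewrite mulrDl -scalerAl lP.
- by rewrite lP /= !mulrDl -!scalerAl scalerDr addrACA.
move: g; apply: mon_ext => [c x y|c x y|m'].
- by rewrite mulrDr -scalerAr lP.
- by rewrite lP /= !mulrDr -!scalerAr scalerDr addrACA.
rewrite -monD !PU mxE -scalerAl -scalerAr -!monD rmorphD scalerDl.
by congr (_ *: mon _ + _ *: mon _); rewrite -!addrA // [- _ + _]addrC.
Qed.

Lemma eulerE m : mon (expo i) * P (mon m) = (m 0 i)%:~R *: mon m.
Proof. by rewrite PU -scalerAr -monD addrC subrK. Qed.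

End MonomialAlgebra.

(** * The degree-one bracket defined by the BV operator *)

Section LinearOnMonomials.
Variables (K : fieldType) (n : nat) (A : comAlgType K) (mon : 'rV[int]_n -> A).
Hypothesis monD : forall a b, mon (a + b) = mon a * mon b.
Hypothesis mon_ext : forall (V : lmodType K) (F G : A -> V),
  linear F -> linear G -> (forall m, F (mon m) = G (mon m)) -> F =1 G.
Variables (S : algType K) (L : {linear A -> S}).

Lemma mon_mult_ext :
  (forall a b, L (mon (a + b)) = L (mon a) * L (mon b)) ->
  forall f g, L (f * g) = L f * L g.
Proof.
move=> LM f g; move: f; apply: mon_ext => [c x y|c x y|m].
- by rewrite mulrDl -scalerAl linearP.
- by rewrite linearP /= mulrDl -scalerAl.
move: g; apply: mon_ext => [c x y|c x y|m'].
- by rewrite mulrDr -scalerAr linearP.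
- by rewrite linearP /= mulrDr -scalerAr.
by rewrite -monD LM.
Qed.

Lemma mon_comm_ext t : (forall m, L (mon m) * t = t * L (mon m)) ->
  forall f, L f * t = t * L f.
Proof.
move=> Lt; apply: mon_ext => [c x y|c x y|m]; last exact: Lt.
- by rewrite linearP /= mulrDl -scalerAl.
- by rewrite linearP /= mulrDr -scalerAr.
Qed.

Variable Dl : {linear S -> S}.

Lemma mon_Delta1_ext t (E : {linear A -> A}) :
  (forall m, Dl (L (mon m) * t) = L (E (mon m))) ->
  forall f, Dl (L f * t) = L (E f).
Proof.
move=> Dt; apply: mon_ext => [c x y|c x y|m]; last exact: Dt.
- by rewrite linearP /= mulrDl -scalerAl linearP.
- by rewrite !linearP.
Qed.

Lemma mon_Delta2_ext s t u (E F : {linear A -> A}) :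
  (forall m, Dl (L (mon m) * s) = L (E (mon m)) * t - L (F (mon m)) * u) ->
  forall f, Dl (L f * s) = L (E f) * t - L (F f) * u.
Proof.
move=> Dt; apply: mon_ext => [c x y|c x y|m]; last exact: Dt.
- by rewrite linearP /= mulrDl -scalerAl linearP.
- rewrite !linearP /= !mulrDl -!scalerAl scalerBr opprD.
  by rewrite addrACA.
Qed.

Variables (r : nat) (th : 'I_r -> S) (eu : 'I_r -> A -> A).
Hypothesis LM : forall f g, L (f * g) = L f * L g.
Hypothesis Lth : forall f i, L f * th i = th i * L f.
Hypothesis euM : forall i f g, eu i (f * g) = eu i f * g + f * eu i g.
Hypothesis Dl1 : forall f i, Dl (L f * th i) = L (eu i f).
Hypothesis Dl2 : forall f i j,
  Dl (L f * (th i * th j)) = L (eu i f) * th j - L (eu j f) * th i.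

(** [Dl2] at [g * h] yields four terms. The one where [eu i] differentiates [g] and the one where
    [eu j] differentiates [h] are cancelled by the two correction terms; what is left is the bracket
    of the vector fields [g * eu i] and [h * eu j]. *)
Lemma Delta_bracket_monomial g h i j :
  Dl (L g * th i * (L h * th j)) - Dl (L g * th i) * (L h * th j)
    + L g * th i * Dl (L h * th j) =
  L (g * eu i h) * th j - L (h * eu j g) * th i.
Proof.
rewrite [L g * th i * (L h * th j)]mulrA -[L g * th i * L h]mulrA -Lth.
rewrite [L g * (L h * th i)]mulrA -LM -mulrA Dl2 !Dl1 !euM.
rewrite [L (eu i g) * _]mulrA -[L g * th i * _]mulrA -Lth mulrA -!LM.
rewrite !linearD /= !mulrDl [h * _]mulrC opprD.
set a := L (eu i g * h) * _; set b := L (g * eu i h) * _.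
set c := L (eu j g * h) * _; set d := L (g * eu j h) * _.
by rewrite [a + b]addrC -!addrA; rewrite [- a + d]addrC addKr
  [a + _]addrCA subrr addr0.
Qed.

Lemma Delta_bracket_sum (g h : 'I_r -> A) (x := \sum_i L (g i) * th i)
    (y := \sum_i L (h i) * th i) :
  Dl (x * y) - Dl x * y + x * Dl y =
  \sum_i L (\sum_j g j * eu j (h i) - \sum_j h j * eu j (g i)) * th i.
Proof.
transitivity (\sum_i \sum_j (L (g i * eu i (h j)) * th j - L (h j * eu j (g i)) * th i)).
  rewrite /x !mulr_suml !linear_sum mulr_suml -sumrB -big_split /=.
  apply: eq_bigr => i _; rewrite /y !mulr_sumr !linear_sum -!big_split /=.
  by apply: eq_bigr => j _; rewrite Delta_bracket_monomial.
under eq_bigr => i _ do rewrite sumrB.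
(* Only the first double sum carries [th j]; exchanging its indices brings both sums under the same
   generator. *)
rewrite sumrB exchange_big /= -sumrB; apply: eq_bigr => i _.
by rewrite linearB /= mulrBl !(linear_sum L) !mulr_suml.
Qed.

End LinearOnMonomials.

(** For [a != b] exactly one of [b < a] and [a < b] holds, so the two signs are opposite. *)
Lemma sign_transpose (K : fieldType) (r : nat) (V : lmodType K) (u v : V) (x y : K)
    (a b : 'I_r) : a != b ->
  ((-1) ^+ (b < a)%N * x) *: u + ((-1) ^+ (a < b)%N * y) *: v =
  (-1) ^+ (b < a)%N *: (x *: u - y *: v).
Proof.
move=> ab; rewrite scalerBr !scalerA -scaleNr -mulNr; congr (_ + (_ * _) *: _).
by case: (ltngtP a b) ab => [_ _|_ _|/val_inj->]; rewrite ?eqxx ?expr1 ?expr0 ?opprK.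
Qed.

(* In the intended model [mon m] is z^m, [eu i] is z_i d/dz_i, [s m I] is
   z^m theta_I, [L] is laurent_to_SH and [Dl] is the BV operator. *)
Section ExteriorMonomials.
Variables (K : fieldType) (r : nat) (A : comAlgType K) (mon : 'rV[int]_r -> A).
Hypotheses (mon0 : mon 0 = 1) (monD : forall a b, mon (a + b) = mon a * mon b).
Hypothesis mon_ext : forall (V : lmodType K) (F G : A -> V),
  linear F -> linear G -> (forall m, F (mon m) = G (mon m)) -> F =1 G.
Variable eu : 'I_r -> {linear A -> A}.
Hypothesis eu_der : forall i, is_derivation (eu i).
Hypothesis euU : forall i m, eu i (mon m) = (m 0 i)%:~R *: mon m.
Variables (S : algType K) (s : 'rV[int]_r -> {set 'I_r} -> S).
Hypothesis s0M : forall m m' I, s m set0 * s m' I = s (m + m') I.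
Hypothesis sM0 : forall m m' I, s m I * s m' set0 = s (m + m') I.
Hypothesis s1M1 : forall i j, s 0 [set i] * s 0 [set j] =
  if i == j then 0 else (-1) ^+ (j < i)%N *: s 0 [set i; j].
Variables (L : {linear A -> S}) (Dl : {linear S -> S}).
Hypothesis LU : forall m, L (mon m) = s m set0.
Hypothesis DlU1 : forall m i, Dl (s m [set i]) = (m 0 i)%:~R *: s m set0.
Hypothesis DlU2 : forall m i j, i != j -> Dl (s m [set i; j]) =
  (-1) ^+ (j < i)%N *: ((m 0 i)%:~R *: s m [set j] - (m 0 j)%:~R *: s m [set i]).
Implicit Types (f g : A) (D E : A -> A).

(** In the intended model this is [sh_of_vf]. *)
Definition log_sum D : S :=
  \sum_(i < r) L (mon (- expo i) * D (mon (expo i))) * s 0 [set i].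

Definition eu_field (g : 'I_r -> A) f : A := \sum_i g i * eu i f.

Lemma log_sum_linear a D E :
  log_sum (fun f => a *: D f + E f) = a *: log_sum D + log_sum E.
Proof.
rewrite /log_sum scaler_sumr -big_split; apply: eq_bigr => i _.
by rewrite mulrDr -scalerAr linearP /= mulrDl -scalerAl.
Qed.

Lemma L_theta i (T : A -> S) : linear T -> (forall m, T (mon m) = s m [set i]) ->
  forall f, L f * s 0 [set i] = T f.
Proof.
move=> linT TU; apply: mon_ext => [c x y||m]; last by rewrite LU s0M addr0 TU.
  by rewrite linearP /= mulrDl -scalerAl.
exact: linT.
Qed.

Lemma eu_expo i j : eu i (mon (expo j)) = (i == j)%:R *: mon (expo j).
Proof. by rewrite euU expoE eq_sym; case: eqP. Qed.

Lemma is_derivation_eu_field (g : 'I_r -> A) : is_derivation (eu_field g).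
Proof. by apply: is_derivation_sum => i _; apply: is_derivation_mulr. Qed.

Lemma eu_field_expo (g : 'I_r -> A) i : eu_field g (mon (expo i)) = g i * mon (expo i).
Proof.
rewrite /eu_field (bigD1 i) //= eu_expo eqxx scale1r.
by rewrite big1 ?addr0 // => j ji; rewrite eu_expo (negPf ji) scale0r mulr0.
Qed.

Lemma logder_eu_field (g : 'I_r -> A) i : mon (- expo i) * eu_field g (mon (expo i)) = g i.
Proof. by rewrite eu_field_expo mulrCA -monD addNr mon0 mulr1. Qed.

(** Both sides are derivations with the same values on the variables. Together with
    [logder_eu_field] this puts derivations in bijection with arbitrary families of [r]
    components. *)
Lemma eu_field_logder D : is_derivation D ->
  eu_field (fun i => mon (- expo i) * D (mon (expo i))) =1 D.
Proof.
move=> derD; apply: (is_derivation_ext mon0 monD mon_ext) => // [|j].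
  exact: is_derivation_eu_field.
by rewrite eu_field_expo mulrAC -monD addNr mon0 mul1r.
Qed.

Lemma log_sum_monomial n i : log_sum (fun f => mon n * eu i f) = s n [set i].
Proof.
have -> : log_sum (fun f => mon n * eu i f) =
    \sum_j L ((i == j)%:R *: mon n) * s 0 [set j].
  apply: eq_bigr => j _; rewrite eu_expo -!scalerAr mulrCA -monD addNr mon0.
  by rewrite mulr1.
rewrite (bigD1 i) //= eqxx scale1r LU s0M addr0 big1 ?addr0 // => j ji.
by rewrite eq_sym (negPf ji) scale0r linear0 mul0r.
Qed.

Lemma log_sum_bracket D E : is_derivation D -> is_derivation E ->
  log_sum (fun f => D (E f) - E (D f)) =
  Dl (log_sum D * log_sum E) - Dl (log_sum D) * log_sum E
    + log_sum D * Dl (log_sum E).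
Proof.
move=> derD derE.
have LM f g : L (f * g) = L f * L g.
  by apply: (mon_mult_ext monD mon_ext) => a b; rewrite !LU s0M.
have Lth f i : L f * s 0 [set i] = s 0 [set i] * L f.
  by apply: (mon_comm_ext mon_ext) => m; rewrite LU s0M sM0 addrC.
have Dl1 f i : Dl (L f * s 0 [set i]) = L (eu i f).
  apply: (mon_Delta1_ext mon_ext) => m.
  by rewrite LU s0M addr0 DlU1 euU linearZ /= LU.
have Dl2 f i j : Dl (L f * (s 0 [set i] * s 0 [set j])) =
    L (eu i f) * s 0 [set j] - L (eu j f) * s 0 [set i].
  rewrite s1M1; case: (eqVneq i j) => [->|ij]; first by rewrite mulr0 linear0 subrr.
  apply: (mon_Delta2_ext mon_ext) => m.
  (* The sign from ordering the product of the two generators meets the same sign in [DlU2], and its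
     square is 1. *)
  rewrite LU -scalerAr s0M addr0 linearZ /= DlU2 // scalerA -expr2 sqrr_sign.
  by rewrite scale1r !euU !linearZ /= LU -!scalerAl !s0M !addr0 scalerN.
rewrite (Delta_bracket_sum LM Lth (fun i => (eu_der i).2) Dl1 Dl2).
apply: eq_bigr => i _; congr (L _ * _).
(* The inner sums are [eu_field]s of the components of [D] and [E], hence [D] and [E] themselves. *)
rewrite -!/(eu_field _ _) !eu_field_logder //.
by rewrite (bracket_log_deriv derD derE) // -monD addNr.
Qed.

End ExteriorMonomials.

(** * Derivations of the Laurent polynomial ring *)

Section LaurentDerivations.
Variables (K : fieldType) (n : nat).
Implicit Types (m : 'rV[int]_n) (f g : laurent K n) (D E : laurent K n -> laurent K n).

Lemma lmonD m m' : lmon (m + m') = lmon m * lmon m' :> laurent K n.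
Proof. exact/esym/bilextU. Qed.

Lemma laurent_linear_ext (V : lmodType K) (F G : laurent K n -> V) :
  linear F -> linear G -> (forall m, F (lmon m) = G (lmon m)) -> F =1 G.
Proof. exact: linear_malg_ext. Qed.

Lemma lmonNK m : lmon (- m) * lmon m = 1 :> laurent K n.
Proof. exact: (monNK (erefl _) lmonD). Qed.

Lemma lvarVK i : lvarV i * lvar i = 1 :> laurent K n.
Proof. exact: lmonNK. Qed.

Lemma mcoeff_lmon m m' : (lmon m : laurent K n)@_m' = (m == m')%:R.
Proof. exact: mcoeffU. Qed.

Definition log_deriv D m : laurent K n := lmon (- m) * D (lmon m).

Lemma log_derivB D m m' : derivation D ->
  log_deriv D (m - m') = log_deriv D m - log_deriv D m'.
Proof. by move=> derD; apply: (logderB (mon := @lmon K n)) => //; apply: lmonD. Qed.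

Lemma lmon_log_deriv D m : lmon m * log_deriv D m = D (lmon m).
Proof. exact: (mon_logder (mon := @lmon K n) (erefl _) lmonD). Qed.

Lemma derivation_ext D E : derivation D -> derivation E ->
  (forall i, D (lvar i) = E (lvar i)) -> D =1 E.
Proof.
exact: (is_derivation_ext (mon := @lmon K n) (erefl _) lmonD laurent_linear_ext).
Qed.

Lemma lpartialU i m : lpartial i (lmon m : laurent K n) = (m 0 i)%:~R *: lmon (m - expo i).
Proof. exact: linextU. Qed.

Lemma lpartial_linear i : linear (@lpartial K n i).
Proof. by rewrite /lpartial; apply: linearP. Qed.

Lemma derivation_lpartial i : derivation (@lpartial K n i).
Proof.
exact: (is_derivation_partial lmonD laurent_linear_ext (@lpartial_linear i) (@lpartialU i)).
Qed.

Definition euler i f : laurent K n := lvar i * lpartial i f.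

Lemma derivation_euler i : derivation (euler i).
Proof. exact: (is_derivation_mulr _ (derivation_lpartial i)). Qed.

Lemma eulerU i m : euler i (lmon m) = (m 0 i)%:~R *: lmon m.
Proof. exact: (eulerE lmonD (@lpartialU i)). Qed.

End LaurentDerivations.

(** * The isomorphism between vector fields on the torus and SH^1 *)

Section VectorFieldsToSH.
Variables (K : fieldType) (r : nat).
Implicit Types (m n : 'rV[int]_r) (I J : {set 'I_r}) (g h : 'I_r -> laurent K r).
Implicit Types (f : laurent K r) (D E : laurent K r -> laurent K r).

HB.instance Definition _ := GRing.Linear.on (@laurent_to_SH K r).
HB.instance Definition _ := GRing.Linear.on (@BV_Delta K r).
HB.instance Definition _ i :=
  GRing.isLinear.Build K (laurent K r) (laurent K r) _ (@euler K r i)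
    (derivation_euler K i).1.

Let eul (i : 'I_r) : {linear laurent K r -> laurent K r} := @euler K r i.

Local Notation shmon := (@shmon K r).

Lemma laurent_to_SHU m : laurent_to_SH (lmon m) = shmon m set0.
Proof. exact: linextU. Qed.

Lemma shmonM m I m' J : shmon m I * shmon m' J = sh_mulU K (m, I) (m', J).
Proof. exact: bilextU. Qed.

Lemma shmon0M m m' I : shmon m set0 * shmon m' I = shmon (m + m') I.
Proof.
rewrite shmonM /sh_mulU /= disjoints_subset sub0set inversions0l scale1r.
by rewrite set0U.
Qed.

Lemma shmonM0 m m' I : shmon m I * shmon m' set0 = shmon (m + m') I.
Proof.
rewrite shmonM /sh_mulU /= disjoint_sym disjoints_subset sub0set inversions0r.
by rewrite scale1r setU0.
Qed.

Lemma laurent_to_SH_theta f i :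
  laurent_to_SH f * theta K i = linext (fun n => shmon n [set i]) f.
Proof.
apply: (L_theta (@laurent_linear_ext K r) shmon0M laurent_to_SHU (i := i)).
  exact: linearP.
by move=> m; apply: linextU.
Qed.

Lemma mcoeff_laurent_theta f i n (I : {set 'I_r}) :
  (laurent_to_SH f * theta K i)@_(n, I) = f@_n *+ (I == [set i]).
Proof.
rewrite laurent_to_SH_theta; have [->|nI] := eqVneq I [set i].
  by apply: (mcoeff_linext_inj f n (h := fun n => (n, [set i]))) => x y [].
apply: (mcoeff_linext_out f (h := fun n => (n, [set i]))) => a.
by apply: contraNneq nI => -[_ ->].
Qed.

(** Separates the family of components from the derivation that produced it, so that injectivity and
    surjectivity become statements about coefficients. *)
Definition sh_of_fun (g : 'I_r -> laurent K r) : SH K r :=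
  \sum_(i < r) laurent_to_SH (g i) * theta K i.

Lemma mcoeff_sh_of_fun g n i : (sh_of_fun g)@_(n, [set i]) = (g i)@_n.
Proof.
have pick_i (c : 'I_r -> K) : \sum_j c j *+ ([set i] == [set j]) = c i.
  rewrite (bigD1 i) //= eqxx big1 ?addr0 // => j ji.
  by rewrite (inj_eq set1_inj) eq_sym (negPf ji).
rewrite -(pick_i (fun j => (g j)@_n)) raddf_sum.
apply: eq_bigr => j _; exact: mcoeff_laurent_theta.
Qed.

Lemma sh_of_fun_inj g h : sh_of_fun g = sh_of_fun h -> g =1 h.
Proof.
move=> gh i; apply/malgP => n.
by rewrite -(mcoeff_sh_of_fun g n i) gh mcoeff_sh_of_fun.
Qed.

Lemma sh_of_fun_ext g h : g =1 h -> sh_of_fun g = sh_of_fun h.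
Proof. by move=> gh; apply: eq_bigr => i _; rewrite gh. Qed.

Lemma sh_of_vfE D : sh_of_vf D = sh_of_fun (fun i => log_deriv D (expo i)).
Proof. by []. Qed.

Lemma sh_of_fun_degree1 g : sh_degree 1 (sh_of_fun g).
Proof.
move=> -[n I] /msupp_sum[i _]; rewrite -mcoeff_neq0 mcoeff_laurent_theta.
by have [->|_] := eqVneq I [set i]; rewrite ?cards1 ?eqxx.
Qed.

(** Subsets of cardinality one are singletons, so all other coefficients of [x] and [y] vanish. *)
Lemma degree1_ext (x y : SH K r) : sh_degree 1 x -> sh_degree 1 y ->
  (forall n i, x@_(n, [set i]) = y@_(n, [set i])) -> x = y.
Proof.
move=> dx dy xy; apply/malgP => -[n I].
have [/eqP/cards1P[i ->]|nI] := eqVneq #|I| 1%N; first exact: xy.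
rewrite !mcoeff_outdom //; first by apply: contra nI => /dy /= ->.
by apply: contra nI => /dx /= ->.
Qed.

Lemma eq_sh_of_vf D E : (forall i, D (lvar i) = E (lvar i)) ->
  sh_of_vf D = sh_of_vf E.
Proof.
move=> DE; apply: (@sh_of_fun_ext (fun i => _) (fun i => _)) => i.
exact: congr1 (DE i).
Qed.

Lemma sh_of_vf_linear a D E :
  sh_of_vf (fun f => a *: D f + E f) = a *: sh_of_vf D + sh_of_vf E.
Proof. exact: (log_sum_linear (@lmon K r) shmon (@laurent_to_SH K r) a D E). Qed.

(** The components determine [D (lvar i)] because [lvar i] is invertible, and a derivation is
    determined by its values on the variables. *)
Lemma sh_of_vf_inj D E : derivation D -> derivation E ->
  sh_of_vf D = sh_of_vf E -> D =1 E.
Proof.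
move=> derD derE DE; apply: (derivation_ext derD derE) => i.
apply: (inverse_mul_inj (lvarVK K i)).
exact: (sh_of_fun_inj DE i).
Qed.

Definition euler_field (g : 'I_r -> laurent K r) f : laurent K r :=
  \sum_i g i * euler i f.

Lemma derivation_euler_field g : derivation (euler_field g).
Proof. exact: (@is_derivation_eu_field K r _ eul (@derivation_euler K r) g). Qed.

Lemma log_deriv_euler_field g i : log_deriv (euler_field g) (expo i) = g i.
Proof. exact: (@logder_eu_field K r _ _ (erefl _) (@lmonD K r) eul (@eulerU K r) g i). Qed.

Lemma sh_of_vf_surj (x : SH K r) : sh_degree 1 x ->
  exists2 D, derivation D & sh_of_vf D = x.
Proof.
(* [g i] collects the coefficients of the elements z^n theta_i of [x] into one Laurent
   polynomial. *)
move=> dx; pose g i : laurent K r :=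
  linext (fun a => if a.2 == [set i] then lmon a.1 else 0) x.
exists (euler_field g); first exact: derivation_euler_field.
have -> : sh_of_vf (euler_field g) = sh_of_fun g.
  exact: (sh_of_fun_ext (log_deriv_euler_field g)).
apply: degree1_ext => // [|n i]; first exact: sh_of_fun_degree1.
rewrite mcoeff_sh_of_fun /g mcoeff_linext.
rewrite [in RHS](malg_basisE x) raddf_sum; apply: eq_bigr => -[m J] _ /=.
rewrite mcoeffZ mcoeffU xpair_eqE andbC; congr (_ * _).
by case: eqP; rewrite ?mcoeff0 // mcoeff_lmon.
Qed.

Lemma sh_of_vf_monomial n i :
  sh_of_vf (fun f : laurent K r => lmon n * (lvar i * lpartial i f))
    = shmon n [set i].
Proof.
exact: (@log_sum_monomial K r _ _ (erefl _) (@lmonD K r) eul (@eulerU K r)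
  _ _ shmon0M _ laurent_to_SHU).
Qed.

Lemma BV_DeltaU m I : BV_Delta (shmon m I) =
  \sum_(i in I) ((-1) ^+ #|[set j in I | (j < i)%N]| * (m 0 i)%:~R)
    *: shmon m (I :\ i).
Proof. exact: linextU. Qed.

Lemma BV_DeltaU1 m i : BV_Delta (shmon m [set i]) = (m 0 i)%:~R *: shmon m set0.
Proof.
rewrite BV_DeltaU big_set1.
rewrite (_ : [set j in _ | _] = set0) ?cards0 ?expr0 ?mul1r ?setDv //.
by apply/setP => j; rewrite !inE; case: eqP => // ->; rewrite ltnn.
Qed.

Lemma thetaM i j : theta K i * theta K j =
  if i == j then 0 else (-1) ^+ (j < i)%N *: shmon 0 [set i; j].
Proof.
have dis : [disjoint [set i] & [set j]] = (i != j) by rewrite disjoints1 inE.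
(* The only candidate for an inversion is the pair (i, j). *)
have inv : inversions [set i] [set j] = (j < i)%N.
  rewrite /inversions.
  rewrite (_ : [set p | _] = if (j < i)%N then [set (i, j)] else set0).
    by case: ifP => _; rewrite ?cards1 ?cards0.
  apply/setP => -[a b]; rewrite !inE /=.
  case: (eqVneq a i) => [->|ai] /=; last first.
    by case: ifP; rewrite !inE // xpair_eqE (negPf ai).
  case: (eqVneq b j) => [->|bj] /=; first by case: ifP; rewrite !inE ?eqxx.
  by case: ifP; rewrite !inE // xpair_eqE (negPf bj) andbF.
apply: etrans (shmonM 0 [set i] 0 [set j]) _.
rewrite /sh_mulU [fst _]/= [snd _]/= dis inv.
case: (i == j); first exact: erefl.
exact (congr1 (fun z => (-1) ^+ (j < i)%N *: shmon z [set i; j]) (addr0 (0 : 'rV[int]_r))).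
Qed.

(** The basis element takes its factors in increasing order; the sign in front converts to the order
    a, b, for which contraction with [m] has the same form in both cases. *)
Lemma BV_Delta_pair m (a b : 'I_r) : a != b ->
  BV_Delta (shmon m [set a; b]) = (-1) ^+ (b < a)%N *:
    ((m 0 a)%:~R *: shmon m [set b] - (m 0 b)%:~R *: shmon m [set a]).
Proof.
move=> ab; rewrite BV_DeltaU big_setU1 ?inE // big_set1.
have lt_card (c d : 'I_r) : c != d ->
    #|[set x in [set c; d] | (x < c)%N]| = (d < c)%N.
  move=> cd; rewrite (_ : [set x in _ | _] = if (d < c)%N then [set d] else set0).
    by case: ifP => _; rewrite ?cards1 ?cards0.
  apply/setP => x; rewrite !inE; case: (eqVneq x c) => [->|xc] /=.
    by rewrite ltnn; case: ifP => [|_]; rewrite inE ?(negPf cd).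
  case: (eqVneq x d) => [->|xd] /=; first by case: ifP; rewrite !inE ?eqxx.
  by case: ifP; rewrite !inE // (negPf xd).
have Da : [set a; b] :\ a = [set b] by rewrite setU1K // inE.
have Db : [set a; b] :\ b = [set a] by rewrite setUC setU1K // inE eq_sym.
have card_a := lt_card _ _ ab.
have card_b : #|[set x in [set a; b] | (x < b)%N]| = (a < b)%N.
  by rewrite setUC lt_card // eq_sym.
rewrite Da Db card_a card_b; exact: sign_transpose.
Qed.

Lemma sh_of_vf_bracket D E : derivation D -> derivation E ->
  sh_of_vf (vf_bracket D E) = sh_bracket (sh_of_vf D) (sh_of_vf E).
Proof.
move=> derD derE.
pose L : {linear laurent K r -> SH K r} := @laurent_to_SH K r.
pose Dl : {linear SH K r -> SH K r} := @BV_Delta K r.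
have := @log_sum_bracket K r (laurent K r) (@lmon K r) (erefl _) (@lmonD K r)
  (@laurent_linear_ext K r) eul (@derivation_euler K r) (@eulerU K r)
  (SH K r) shmon shmon0M shmonM0 thetaM L Dl laurent_to_SHU BV_DeltaU1 BV_Delta_pair
  D E derD derE.
by rewrite /log_sum /sh_bracket /sh_of_vf /vf_bracket; apply.
Qed.

End VectorFieldsToSH.

(** * The A_r root lattice *)

Section RootLattice.
Variable r : nat.
Implicit Types (m n : 'rV[int]_r) (k : 'rV[int]_r.+1) (i j : 'I_r.+1).

(** The effect of Z_0 = 1 on exponents. It is a left inverse of [root_embed], and two-sided on
    vectors of coordinate sum zero. *)
Definition dehom k : 'rV[int]_r := \row_i k 0 (lift ord0 i).

Lemma dehomE k (i : 'I_r) : dehom k 0 i = k 0 (lift ord0 i). Proof. by rewrite mxE. Qed.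

Lemma expoBE i j (l : 'I_r.+1) :
  (expo i - expo j) 0 l = (i == l)%:R - (j == l)%:R.
Proof. by rewrite mxE [X in _ + X]mxE !expoE. Qed.

Lemma root_embedE m (l : 'I_r.+1) : root_embed m 0 l =
  \sum_(i < r) m 0 i * ((lift ord0 i == l)%:R - (ord0 == l)%:R).
Proof.
rewrite /root_embed summxE; apply: eq_bigr => i _.
by rewrite mxE expoBE.
Qed.

Lemma root_embed_lift m (i : 'I_r) : root_embed m 0 (lift ord0 i) = m 0 i.
Proof.
rewrite root_embedE (bigD1 i) //= eqxx subr0 mulr1 big1 ?addr0 // => j ji.
by rewrite (inj_eq lift_inj) (negPf ji) subr0 mulr0.
Qed.

Lemma root_embed_sum m : \sum_i root_embed m 0 i = 0.
Proof.
under eq_bigr => i _ do rewrite root_embedE.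
rewrite exchange_big big1 // => j _.
rewrite -mulr_sumr sumrB.
have one i : \sum_(l < r.+1) (i == l)%:R = 1 :> int.
  by rewrite (bigD1 i) //= eqxx big1 ?addr0 // => l li; rewrite eq_sym (negPf li).
by rewrite !one subrr mulr0.
Qed.

(** The coordinate at 0 is minus the sum of the others. *)
Lemma sum_zero_ext k k' : \sum_i k 0 i = 0 -> \sum_i k' 0 i = 0 ->
  (forall i : 'I_r, k 0 (lift ord0 i) = k' 0 (lift ord0 i)) -> k = k'.
Proof.
move=> k0 k'0 kk'; apply/rowP => i; case: (unliftP ord0 i) => [j ->//|->].
move: k0 k'0; rewrite !big_ord_recl (eq_bigr _ (fun (i : 'I_r) _ => kk' i)) => /eqP.
by rewrite addr_eq0 => /eqP-> /eqP; rewrite addr_eq0 => /eqP->.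
Qed.

Lemma dehomK k : \sum_i k 0 i = 0 -> root_embed (dehom k) = k.
Proof.
move=> k0; apply: sum_zero_ext => // [|i]; first exact: root_embed_sum.
by rewrite root_embed_lift mxE.
Qed.

Lemma root_embedK m : dehom (root_embed m) = m.
Proof. by apply/rowP => i; rewrite mxE root_embed_lift. Qed.

Lemma dehomD k k' : dehom (k + k') = dehom k + dehom k'.
Proof. by apply/rowP => i; rewrite !mxE. Qed.

Lemma root_embedD m n : root_embed (m + n) = root_embed m + root_embed n.
Proof.
rewrite /root_embed -big_split; apply: eq_bigr => i _ /=.
by rewrite mxE scalerDl.
Qed.

Lemma root_embed0 : root_embed (0 : 'rV[int]_r) = 0.
Proof. by rewrite /root_embed big1 // => i _; rewrite mxE scale0r. Qed.

Lemma root_embed_inj : injective (@root_embed r).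
Proof. exact: can_inj root_embedK. Qed.

Lemma expo_sum i : \sum_l @expo r.+1 i 0 l = 1.
Proof.
rewrite (bigD1 i) //= expoE eqxx big1 ?addr0 // => l li.
by rewrite expoE eq_sym (negPf li).
Qed.

(** The exponent of Z_i / Z_j in the affine coordinates, that is, the root e_i - e_j. *)
Definition root_vec i j : 'rV[int]_r := dehom (expo i - expo j).

Lemma root_embed_root i j : root_embed (root_vec i j) = expo i - expo j.
Proof.
apply: dehomK; under eq_bigr => l _ do rewrite expoBE -!expoE.
by rewrite sumrB !expo_sum subrr.
Qed.

Lemma expo_eq_root (i : 'I_r) : expo i = root_vec (lift ord0 i) ord0.
Proof.
apply/rowP => l; rewrite dehomE expoBE (inj_eq lift_inj) expoE.
by rewrite [ord0 == _](negPf (neq_lift _ _)) subr0.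
Qed.

Lemma root_eq0 i : root_vec i i = 0.
Proof. by apply: root_embed_inj; rewrite root_embed_root subrr root_embed0. Qed.

(** For [i != j] the vector e_i - e_j has value 1 at [i] and -1 at [j]; comparing these two
    coordinates with those of e_a - e_b identifies the indices. *)
Lemma expoB_eq i j a b : i != j -> expo i - expo j = expo a - expo b -> i = a /\ j = b.
Proof.
move=> ij e.
have ei : (expo i - expo j) 0 i = (expo a - expo b) 0 i by rewrite e.
have ej : (expo i - expo j) 0 j = (expo a - expo b) 0 j by rewrite e.
move: ei ej; rewrite !expoBE !eqxx [j == i]eq_sym (negPf ij) /=.
by case: (eqVneq a i) => [->|_]; case: (eqVneq b j) => [->|_]; case: eqP; case: eqP.
Qed.

Lemma root_inj i j a b : i != j -> root_vec i j = root_vec a b -> i = a /\ j = b.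
Proof.
by move=> ij /(congr1 (@root_embed r)); rewrite !root_embed_root; apply: expoB_eq.
Qed.

Lemma root_neq0 i j : i != j -> root_vec i j != 0.
Proof.
move=> ij; apply/eqP; rewrite -(root_eq0 i) => /(root_inj ij)[_ ji].
by rewrite ji eqxx in ij.
Qed.

End RootLattice.

(** * Restriction from projective space *)

Section MonomialRestriction.
Variables (K : fieldType) (r : nat) (A B : comAlgType K).
Variables (zA : 'rV[int]_r -> A) (zB : 'rV[int]_r.+1 -> B).
Hypotheses (zA0 : zA 0 = 1) (zAD : forall a b, zA (a + b) = zA a * zA b).
Hypotheses (zB0 : zB 0 = 1) (zBD : forall a b, zB (a + b) = zB a * zB b).
Hypothesis zA_ext : forall (V : lmodType K) (F G : A -> V),
  linear F -> linear G -> (forall m, F (zA m) = G (zA m)) -> F =1 G.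
Hypothesis zB_ext : forall (V : lmodType K) (F G : B -> V),
  linear F -> linear G -> (forall m, F (zB m) = G (zB m)) -> F =1 G.
Variables (hom : {linear A -> B}) (deh : {linear B -> A}).
Hypothesis homU : forall m, hom (zA m) = zB (root_embed m).
Hypothesis dehU : forall k, deh (zB k) = zA (dehom k).
Variable P : 'I_r.+1 -> B -> B.
Hypothesis P_der : forall j, is_derivation (P j).
Hypothesis PU : forall j k, P j (zB k) = (k 0 j)%:~R *: zB (k - expo j).
Implicit Types (M N : 'M[K]_r.+1).

Definition linear_vf M (f : B) : B :=
  \sum_(i < r.+1) \sum_(j < r.+1) M i j *: (zB (expo i) * P j f).

Definition restricted_vf M (f : A) : A := deh (linear_vf M (hom f)).

Lemma is_derivation_linear_vf M : is_derivation (linear_vf M).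
Proof.
do 2![apply: is_derivation_sum => ? _].
by apply/is_derivation_scale/is_derivation_mulr.
Qed.

Lemma linear_vfU M k : linear_vf M (zB k) =
  \sum_i \sum_j (M i j * (k 0 j)%:~R) *: zB (k + (expo i - expo j)).
Proof.
apply: eq_bigr => i _; apply: eq_bigr => j _.
by rewrite PU -scalerAr scalerA -zBD addrCA.
Qed.

Lemma linear_vf_expo M l : linear_vf M (zB (expo l)) = \sum_i M i l *: zB (expo i).
Proof.
rewrite linear_vfU; apply: eq_bigr => i _.
rewrite (bigD1 l) //= expoE eqxx mulr1 addrCA subrr addr0 big1 ?addr0 // => j jl.
by rewrite expoE eq_sym (negPf jl) mulr0 scale0r.
Qed.

(** Both sides are derivations, so it suffices to compare them on the Z_l. On linear forms the
    fields act by their matrices, and composition is the matrix product in the same order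
    ([comp_expo]). *)
Lemma linear_vf_bracket M N f :
  linear_vf M (linear_vf N f) - linear_vf N (linear_vf M f) =
  linear_vf (mx_bracket M N) f.
Proof.
have derV := is_derivation_linear_vf; move: f.
apply: (is_derivation_ext zB0 zBD zB_ext) => [|//|l]; first exact: is_derivation_bracket.
have comp_expo M1 M2 : linear_vf M1 (linear_vf M2 (zB (expo l))) =
    \sum_i (M1 *m M2) i l *: zB (expo i).
  rewrite linear_vf_expo vf_sum //.
  under eq_bigr => k _ do rewrite vfZ // linear_vf_expo scaler_sumr.
  rewrite exchange_big; apply: eq_bigr => i _ /=.
  by rewrite mxE scaler_suml; apply: eq_bigr => k _; rewrite scalerA mulrC.
rewrite !comp_expo linear_vf_expo -sumrB; apply: eq_bigr => i _.
by rewrite -scalerBl /mx_bracket [in RHS]mxE [X in _ = (_ + X) *: _]mxE.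
Qed.

Lemma homM f g : hom (f * g) = hom f * hom g.
Proof. by apply: (mon_mult_ext zAD zA_ext) => a b; rewrite !homU root_embedD zBD. Qed.

Lemma dehM f g : deh (f * g) = deh f * deh g.
Proof. by apply: (mon_mult_ext zBD zB_ext) => a b; rewrite !dehU dehomD zAD. Qed.

Lemma homK f : deh (hom f) = f.
Proof.
move: f; apply: zA_ext => [c x y|c x y|m]; rewrite ?linearP //.
by rewrite homU dehU root_embedK.
Qed.

(** Each Z_i D_j preserves total degree, and in degree zero homogenization inverts dehomogenization.
    Compositions of restricted fields can therefore be computed in homogeneous coordinates. *)
Lemma linear_vf_homogeneous M f :
  hom (deh (linear_vf M (hom f))) = linear_vf M (hom f).
Proof.
have [linV _] := is_derivation_linear_vf M.
move: f; apply: zA_ext => [c x y|c x y|m].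
- by rewrite linearP linV !linearP.
- by rewrite linearP linV.
rewrite homU linear_vfU !linear_sum; apply: eq_bigr => i _.
rewrite !linear_sum; apply: eq_bigr => j _; rewrite !linearZ /= dehU homU dehomK //.
under eq_bigr => l _ do rewrite mxE.
rewrite big_split /= root_embed_sum add0r -root_embed_root.
exact: root_embed_sum.
Qed.

Lemma is_derivation_restricted_vf M : is_derivation (restricted_vf M).
Proof.
have [linV VM] := is_derivation_linear_vf M; split=> [c x y|x y].
  by rewrite /restricted_vf linearP linV linearP.
by rewrite /restricted_vf homM VM linearD /= !dehM !homK.
Qed.

Lemma restricted_vf_bracket M N f :
  restricted_vf M (restricted_vf N f) - restricted_vf N (restricted_vf M f) =
  restricted_vf (mx_bracket M N) f.
Proof.
by rewrite /restricted_vf !linear_vf_homogeneous -linearB linear_vf_bracket.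
Qed.

Lemma restricted_vf_linear c M N f :
  restricted_vf (c *: M + N) f = c *: restricted_vf M f + restricted_vf N f.
Proof.
rewrite /restricted_vf -linearP; congr (deh _).
rewrite /linear_vf scaler_sumr -big_split; apply: eq_bigr => i _.
rewrite scaler_sumr -big_split; apply: eq_bigr => j _.
by rewrite !mxE scalerDl scalerA.
Qed.

Lemma restricted_vfU M m : restricted_vf M (zA m) =
  \sum_i \sum_j (M i j * (root_embed m 0 j)%:~R) *: zA (m + root_vec i j).
Proof.
rewrite /restricted_vf homU linear_vfU linear_sum; apply: eq_bigr => i _.
rewrite linear_sum; apply: eq_bigr => j _.
by rewrite linearZ /= dehU dehomD root_embedK.
Qed.

(** The Euler field multiplies a monomial by its total degree, which is zero for every homogenized
    monomial. *)
Lemma restricted_vf_scalar c f : restricted_vf c%:M f = 0.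
Proof.
move: f; apply: (zA_ext (G := fun=> 0)) => [||m].
- exact: (is_derivation_restricted_vf _).1.
- by move=> a x y; rewrite scaler0 addr0.
rewrite restricted_vfU.
transitivity (\sum_i (c * (root_embed m 0 i)%:~R) *: zA m).
  apply: eq_bigr => i _; rewrite (bigD1 i) //= mxE eqxx mulr1n root_eq0 addr0.
  by rewrite big1 ?addr0 // => j ji; rewrite mxE eq_sym (negPf ji) mul0r scale0r.
by rewrite -scaler_suml -mulr_sumr -rmorph_sum root_embed_sum mulr0 scale0r.
Qed.

Lemma restricted_vf_logder M m : zA (- m) * restricted_vf M (zA m) =
  \sum_i \sum_j (M i j * (root_embed m 0 j)%:~R) *: zA (root_vec i j).
Proof.
rewrite restricted_vfU mulr_sumr; apply: eq_bigr => i _.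
rewrite mulr_sumr; apply: eq_bigr => j _.
by rewrite -scalerAr -zAD addKr.
Qed.

End MonomialRestriction.

(** * Restriction of linear vector fields, for Laurent polynomials *)

Section Restriction.
Variables (K : fieldType) (r : nat).
Implicit Types (M N : 'M[K]_r.+1) (m n : 'rV[int]_r) (i j : 'I_r.+1).

HB.instance Definition _ := GRing.Linear.on (@homogenize K r).
HB.instance Definition _ := GRing.Linear.on (@dehomogenize K r).

Let hom : {linear laurent K r -> laurent K r.+1} := @homogenize K r.
Let deh : {linear laurent K r.+1 -> laurent K r} := @dehomogenize K r.

Lemma homogenizeU m : homogenize (lmon m) = lmon (root_embed m) :> laurent K r.+1.
Proof. exact: linextU. Qed.

Lemma dehomogenizeU (k : 'rV[int]_r.+1) :
  dehomogenize (lmon k) = lmon (dehom k) :> laurent K r.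
Proof. exact: linextU. Qed.

Lemma derivation_restrict_vf M : derivation (restrict_vf M).
Proof.
exact: (is_derivation_restricted_vf (hom := hom) (deh := deh) (@lmonD K r) (@lmonD K r.+1)
  (@laurent_linear_ext K r) (@laurent_linear_ext K r.+1) homogenizeU dehomogenizeU
  (@derivation_lpartial K r.+1)).
Qed.

Lemma restrict_vf_bracket M N f :
  vf_bracket (restrict_vf M) (restrict_vf N) f = restrict_vf (mx_bracket M N) f.
Proof.
exact: (restricted_vf_bracket (hom := hom) (deh := deh) (erefl _) (@lmonD K r.+1)
  (@laurent_linear_ext K r) (@laurent_linear_ext K r.+1) homogenizeU dehomogenizeU
  (@derivation_lpartial K r.+1) (@lpartialU K r.+1)).
Qed.

Lemma restrict_vf_linear c M N f :
  restrict_vf (c *: M + N) f = c *: restrict_vf M f + restrict_vf N f.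
Proof. exact: (restricted_vf_linear _ hom deh). Qed.

Lemma restrict_vf_scalar c f : restrict_vf (c%:M : 'M[K]_r.+1) f = 0.
Proof.
exact: (restricted_vf_scalar (hom := hom) (deh := deh) (@lmonD K r) (@lmonD K r.+1)
  (@laurent_linear_ext K r) (@laurent_linear_ext K r.+1) homogenizeU dehomogenizeU
  (@derivation_lpartial K r.+1) (@lpartialU K r.+1)).
Qed.

Lemma restrict_vfU M m : restrict_vf M (lmon m) =
  \sum_i \sum_j (M i j * (root_embed m 0 j)%:~R) *: lmon (m + root_vec i j).
Proof.
exact: (restricted_vfU (hom := hom) (deh := deh) (@lmonD K r.+1)
  homogenizeU dehomogenizeU (@lpartialU K r.+1)).
Qed.

Lemma log_deriv_restrict_vf M m : log_deriv (restrict_vf M) m =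
  \sum_i \sum_j (M i j * (root_embed m 0 j)%:~R) *: lmon (root_vec i j).
Proof.
exact: (restricted_vf_logder (hom := hom) (deh := deh) (@lmonD K r) (@lmonD K r.+1)
  homogenizeU dehomogenizeU
  (@lpartialU K r.+1)).
Qed.
End Restriction.

(** * Coefficients of restricted fields and the kernel of restriction *)

Section RootWeights.
Variables (K : fieldType) (r : nat).
Implicit Types (M N : 'M[K]_r.+1) (m n : 'rV[int]_r) (i j : 'I_r.+1).

(** Plays the role of h_n(j) for the field of [M]: at [n = 0] it is the diagonal entry [M j j], and
    at a root e_a - e_b it is [M a b] for [j = b] and zero elsewhere. *)
Definition root_weight M n j : K := \sum_i M i j *+ (root_vec i j == n).

Lemma root_weight0 M j : root_weight M 0 j = M j j.
Proof.
rewrite /root_weight (bigD1 j) //= root_eq0 eqxx big1 ?addr0 // => i ij.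
by rewrite (negPf (root_neq0 ij)).
Qed.

Lemma root_weight_root M (a b j : 'I_r.+1) : a != b ->
  root_weight M (root_vec a b) j = M a b *+ (j == b).
Proof.
move=> ab; rewrite /root_weight (bigD1 a) //= big1 => [|i ia]; last first.
  case: eqP => // /esym/(root_inj ab)[ai _]; by rewrite ai eqxx in ia.
rewrite addr0; case: (eqVneq j b) => [->|jb]; first by rewrite eqxx.
case: eqP => // /esym/(root_inj ab)[_ bj]; by rewrite bj eqxx in jb.
Qed.

Lemma root_weight_neq0 M n j : root_weight M n j != 0 ->
  exists2 i, M i j != 0 & n = root_vec i j.
Proof.
move=> nz; have /existsP[i /andP[Mij /eqP nE]] :
    [exists i, (M i j != 0) && (root_vec i j == n)].
  apply: contraNT nz => /existsPn h; rewrite /root_weight big1 // => i _.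
  have := h i; rewrite negb_and negbK => /orP[/eqP->|/negPf->] //.
  by rewrite mul0rn.
by exists i.
Qed.

Lemma root_weight_linear c M N n j :
  root_weight (c *: M + N) n j = c * root_weight M n j + root_weight N n j.
Proof.
rewrite /root_weight mulr_sumr -big_split; apply: eq_bigr => i _.
by rewrite !mxE mulrnDl mulrnAr.
Qed.

Lemma mcoeff_log_deriv_restrict_vf M m n :
  (log_deriv (restrict_vf M) m)@_n =
  \sum_j (root_embed m 0 j)%:~R * root_weight M n j.
Proof.
have -> : (log_deriv (restrict_vf M) m)@_n =
    \sum_i \sum_j (M i j * (root_embed m 0 j)%:~R) * (root_vec i j == n)%:R.
  rewrite log_deriv_restrict_vf raddf_sum; apply: eq_bigr => i _.
  rewrite raddf_sum; apply: eq_bigr => j _.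
  by rewrite /= mcoeffZ mcoeff_lmon.
rewrite exchange_big; apply: eq_bigr => j _; rewrite /root_weight mulr_sumr.
by apply: eq_bigr => i _; rewrite mulr_natr mulrnAr [M i j * _]mulrC.
Qed.

Lemma sum_root_embed_root (F : 'I_r.+1 -> K) i j :
  \sum_l (root_embed (root_vec i j) 0 l)%:~R * F l = F i - F j.
Proof.
under eq_bigr => l _ do rewrite root_embed_root expoBE rmorphB mulrBl /=.
rewrite sumrB; congr (_ - _).
  rewrite (bigD1 i) //= eqxx mul1r big1 ?addr0 // => l li.
  by rewrite eq_sym (negPf li) mul0r.
rewrite (bigD1 j) //= eqxx mul1r big1 ?addr0 // => l lj.
by rewrite eq_sym (negPf lj) mul0r.
Qed.

Lemma mcoeff_log_deriv_restrict_root M n i j :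
  (log_deriv (restrict_vf M) (root_vec i j))@_n = root_weight M n i - root_weight M n j.
Proof. by rewrite mcoeff_log_deriv_restrict_vf sum_root_embed_root. Qed.

(** The weights of the difference do not depend on the index. At exponent 0 this makes its diagonal
    constant; at e_i - e_j, where only the weight at [j] can be non-zero, it kills the entry (i,
    j). *)
Lemma root_weight_scalar M N :
  (forall n i, root_weight M n i - root_weight M n ord0 =
               root_weight N n i - root_weight N n ord0) ->
  M - N = (M 0 0 - N 0 0)%:M.
Proof.
move=> MN.
have D n i j : root_weight (- 1 *: N + M) n i = root_weight (- 1 *: N + M) n j.
  have eq0 l : root_weight (- 1 *: N + M) n l = root_weight (- 1 *: N + M) n ord0.
    rewrite !root_weight_linear; have := MN n l.
    move=> /eqP; rewrite subr_eq => /eqP->; ring.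
  by rewrite !eq0.
rewrite addrC -scaleN1r; set Q := _ + _.
have -> : M 0 0 - N 0 0 = Q 0 0 by rewrite /Q !mxE mulN1r addrC.
apply/matrixP => i j; rewrite [RHS]mxE; case: (eqVneq i j) => [->|ij].
  by rewrite mulr1n -!root_weight0; apply: D.
have := D (root_vec i j) j i; rewrite !root_weight_root // eqxx (negPf ij).
by rewrite mulr1n mulr0n.
Qed.

Lemma restrict_vf_eq M N :
  restrict_vf M =1 restrict_vf N <-> exists c : K, M - N = c%:M.
Proof.
split=> [MN|[c MNc] f].
  exists (M 0 0 - N 0 0); apply: root_weight_scalar => n i.
  rewrite -!mcoeff_log_deriv_restrict_root /log_deriv.
  exact: (congr1 (fun x => (lmon _ * x : laurent K r)@_n) (MN _)).
have -> : M = 1 *: c%:M + N by rewrite scale1r -MNc subrK.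
by rewrite restrict_vf_linear restrict_vf_scalar scaler0 add0r.
Qed.

Lemma sl_class_restrict M : restrict_vf (sl_class M) =1 restrict_vf M.
Proof.
apply/restrict_vf_eq; exists (- (\tr M / r.+1%:R)).
by rewrite /sl_class addrAC subrr add0r raddfN.
Qed.

Lemma sl_to_SHE M :
  sl_to_SH M = sh_of_fun
    (fun i : 'I_r => log_deriv (restrict_vf M) (root_vec (lift ord0 i) ord0)).
Proof.
rewrite /sl_to_SH sh_of_vfE; apply: sh_of_fun_ext => i.
exact: (congr1 (log_deriv _) (expo_eq_root i)).
Qed.

Lemma mcoeff_sl_to_SH M n (i : 'I_r) :
  (sl_to_SH M)@_(n, [set i]) = root_weight M n (lift ord0 i) - root_weight M n ord0.
Proof.
rewrite sl_to_SHE; apply: etrans (mcoeff_log_deriv_restrict_root M n _ _).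
exact: (mcoeff_sh_of_fun
  (fun i : 'I_r => log_deriv (restrict_vf M) (root_vec (lift ord0 i) ord0))).
Qed.

Lemma sl_to_SH_degree1 M : sh_degree 1 (sl_to_SH M).
Proof. exact: sh_of_fun_degree1. Qed.

Lemma sl_to_SH_linear c M N : sl_to_SH (c *: M + N) = c *: sl_to_SH M + sl_to_SH N.
Proof.
apply: etrans (sh_of_vf_linear c (restrict_vf M) (restrict_vf N)).
by apply: eq_sh_of_vf => i; apply: restrict_vf_linear.
Qed.

Lemma sl_to_SH_bracket M N :
  sl_to_SH (mx_bracket M N) = sh_bracket (sl_to_SH M) (sl_to_SH N).
Proof.
apply: etrans (sh_of_vf_bracket (derivation_restrict_vf M) (derivation_restrict_vf N)).
by apply: eq_sh_of_vf => i; apply/esym/restrict_vf_bracket.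
Qed.

Lemma sl_to_SH_class M : sl_to_SH (sl_class M) = sl_to_SH M.
Proof. by apply: eq_sh_of_vf => i; apply: sl_class_restrict. Qed.

Lemma sl_to_SH_support M a : a \in msupp (sl_to_SH M) ->
  exists i j, M i j != 0 /\ a.1 = root_vec i j.
Proof.
case: a => n I aM; have /eqP/cards1P[i Ii] := sl_to_SH_degree1 aM.
move: aM; rewrite -mcoeff_neq0 [I]Ii mcoeff_sl_to_SH /= => nz.
(* The coefficient is a difference of two weights, so at least one of them is non-zero. *)
have [z|/root_weight_neq0[k Mk ->]] := eqVneq (root_weight M n (lift ord0 i)) 0; last first.
  by exists k, (lift ord0 i).
have /root_weight_neq0[k Mk ->] : root_weight M n ord0 != 0.
  by apply: contraNneq nz => ->; rewrite z subrr.
by exists k, ord0.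
Qed.

End RootWeights.

(** * Vector fields that extend to projective space *)

Section Extension.
Variables (K : fieldType) (r : nat).
Implicit Types (M N : 'M[K]_r.+1) (m n : 'rV[int]_r) (i j k l : 'I_r.+1).
Implicit Types (f : laurent K r) (D : laurent K r -> laurent K r).

(** The combinatorial core of the determination of the image; the hypothesis [H] is what regularity
    in all charts says about the weights [h] at the exponent [n]. *)
Lemma root_of_weights (h : 'I_r.+1 -> K) n :
  (forall j k, h j != h k ->
     forall l, l != k -> 0 <= (j == l)%:R + root_embed n 0 l) ->
  n != 0 -> (exists j k, h j != h k) ->
  exists a b, [/\ a != b, n = root_vec a b & forall j, j != b -> h j = h a].
Proof.
move=> H n0 [p [q hpq]]; pose x l := root_embed n 0 l.
have x_sum : \sum_l x l = 0 by apply: root_embed_sum.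
(* Two different values of [h] away from [b] would, by [H] at the coordinate [b], force
   [0 <= x b]. *)
have const_off b : x b < 0 -> forall j k, j != b -> k != b -> h j = h k.
  move=> xb j k jb kb; apply/eqP; apply: contraTT xb => /H/(_ b).
  by rewrite eq_sym kb (negPf jb) add0r -leNgt => /(_ isT).
(* The coordinates sum to zero, so if none were negative all would vanish. *)
have [b xb] : exists b, x b < 0.
  apply/existsP; apply: contraNT n0 => /existsPn xge.
  have {}xge l : 0 <= x l by rewrite leNgt xge.
  have /eqP := x_sum; rewrite psumr_eq0 // => /allP x0.
  apply/eqP/root_embed_inj; rewrite root_embed0; apply/rowP => l.
  by rewrite mxE; apply/eqP/x0; rewrite mem_index_enum.
have [c cb hcb] : exists2 c, c != b & h c != h b.
  have [pb|pb] := eqVneq p b; first by exists q; rewrite -pb;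
    [apply: contraNneq hpq => ->|rewrite eq_sym].
  have [qb|qb] := eqVneq q b; first by exists p; rewrite // -qb.
  by rewrite (const_off b xb p q pb qb) eqxx in hpq.
(* [H] for the pair (b, c) at the coordinate [b] gives [0 <= 1 + x b]. *)
have xb1 : x b = -1.
  have := H b c; rewrite eq_sym => /(_ hcb b); rewrite eqxx eq_sym => /(_ cb).
  by rewrite -/(x b); lia.
(* A second negative coordinate [l] makes [h] constant away from [l] too. As the sum is zero there
   is a third index [d], and it links the two regions of constancy, giving [h c = h b]. *)
have x_ge0 l : l != b -> 0 <= x l.
  move=> lb; rewrite leNgt; apply/negP => xl.
  have [d /andP[db dl]] : exists d, (d != b) && (d != l).
    apply/existsP; apply: contraT => /existsPn no_d.
    move: x_sum; rewrite (bigD1 b) //= (bigD1 l) //= big_pred0; first by lia.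
    by move=> d; rewrite (negPf (no_d d)).
  have hd : h d = h b by apply: (const_off l xl); rewrite // eq_sym.
  case: (eqVneq c l) => [cl|cl].
    by rewrite -hd (const_off b xb c d cb db) eqxx in hcb.
  by rewrite (const_off l xl c b cl) ?eqxx // eq_sym in hcb.
have sum_b : \sum_(l | l != b) x l = 1.
  by move: x_sum => /eqP; rewrite (bigD1 b) //= xb1 addrC subr_eq0 => /eqP.
(* Away from [b] the coordinates are non-negative integers with sum 1, so exactly one of them is
   1. *)
have [a ab xa] : exists2 a, a != b & 0 < x a.
  have /existsP[a /andP[ab xa]] : [exists a, (a != b) && (0 < x a)].
    apply: contraT => /existsPn le0; move: sum_b; rewrite big1 // => l lb.
    have := le0 l; rewrite lb /= -leNgt => xl; apply/eqP; rewrite eq_le xl /=.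
    exact: x_ge0.
  by exists a.
have rest_ge0 : 0 <= \sum_(l | (l != b) && (l != a)) x l.
  by apply: sumr_ge0 => l /andP[lb _]; apply: x_ge0.
have split_a : x a + \sum_(l | (l != b) && (l != a)) x l = 1.
  by rewrite -sum_b [in RHS](bigD1 a).
have xa1 : x a = 1 by lia.
have rest0 : \sum_(l | (l != b) && (l != a)) x l = 0.
  by lia.
exists a, b; split=> // [|j jb]; last exact: (const_off b xb j a jb ab).
apply/root_embed_inj; rewrite root_embed_root; apply/rowP => l.
rewrite expoBE -/(x l) ![_ == l]eq_sym.
have [->|lb] := eqVneq l b; first by rewrite xb1 [b == a]eq_sym (negPf ab) sub0r.
have [->|la] := eqVneq l a; first by rewrite xa1 subr0.
have /eqP := rest0; rewrite psumr_eq0 => [/allP/(_ l)|d /andP[db _]]; last exact: x_ge0.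
by rewrite mem_index_enum lb la /= => /(_ isT)/eqP.
Qed.

Lemma bool_natr_neq0 (b : bool) : (b%:R : K) != 0 -> b.
Proof. by case: b; rewrite ?eqxx. Qed.

Lemma mcoeff_lmonM m f n : (lmon m * f)@_(m + n) = f@_n.
Proof.
have -> : lmon m * f = linext (fun b => << m + b >>) f by exact: linextU.
exact: (mcoeff_linext_inj f n (addrI m)).
Qed.

Lemma mcoeff_apply_lmon D m n : (D (lmon m))@_(m + n) = (log_deriv D m)@_n.
Proof.
apply: etrans (mcoeff_lmonM m (log_deriv D m) n).
exact: (congr1 (fun f : laurent K r => f@_(m + n)) (esym (lmon_log_deriv D m))).
Qed.

(** The function h_n. Since e_j alone is not an exponent on the torus, e_j - e_0 is used, which
    normalizes h_n to vanish at 0 when [D] is a derivation. *)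
Definition vf_weight D n j : K := (log_deriv D (root_vec j ord0))@_n.

Lemma root_vecB i j k : root_vec i k - root_vec j k = root_vec i j.
Proof.
apply/rowP => l; rewrite mxE [X in _ + X]mxE !dehomE !expoBE.
by rewrite opprB addrA subrK.
Qed.

Lemma mcoeff_log_deriv_root D n j k : derivation D ->
  (log_deriv D (root_vec j k))@_n = vf_weight D n j - vf_weight D n k.
Proof. by move=> derD; rewrite -(root_vecB _ _ ord0) log_derivB // mcoeffB. Qed.

(** Test [D] on Z_j / Z_k, which is regular on the chart of [k]: its image contains the monomial of
    exponent n + e_j - e_k with coefficient the difference of the weights. *)
Lemma extends_to_P_weight D n j k : derivation D -> extends_to_P D ->
  vf_weight D n j != vf_weight D n k ->
  forall l, l != k -> 0 <= (j == l)%:R + root_embed n 0 l.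
Proof.
move=> derD extD hjk l lk.
have reg : regular_on_chart k (lmon (root_vec j k) : laurent K r).
  move=> p; rewrite -mcoeff_neq0 mcoeff_lmon => /bool_natr_neq0/eqP <- s sk.
  by rewrite root_embed_root expoBE [k == s]eq_sym (negPf sk) subr0 ler0n.
have := extD k _ reg (root_vec j k + n).
rewrite -mcoeff_neq0 mcoeff_apply_lmon mcoeff_log_deriv_root // subr_eq0 => /(_ hjk l lk).
by rewrite root_embedD mxE root_embed_root expoBE [k == l]eq_sym (negPf lk) subr0.
Qed.

Lemma extends_to_P_restrict D : derivation D -> extends_to_P D ->
  exists M, D =1 restrict_vf M.
Proof.
move=> derD extD; pose h n j := vf_weight D n j.
(* The diagonal is read off at exponent 0; the entry (i, j) is the jump of the weight at [j] for the
   exponent e_i - e_j. *)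
pose M : 'M[K]_r.+1 := \matrix_(i, j)
  (if i == j then h 0 j else h (root_vec i j) j - h (root_vec i j) i).
exists M; apply: (sh_of_vf_inj derD (derivation_restrict_vf M)).
apply: degree1_ext => [||n i]; [exact: sh_of_fun_degree1|exact: sh_of_fun_degree1|].
apply: etrans (esym (mcoeff_sl_to_SH M n i)).
apply: etrans (mcoeff_sh_of_fun _ n i) _.
apply: etrans (congr1 (fun m => (log_deriv D m)@_n) (expo_eq_root i)) _.
rewrite mcoeff_log_deriv_root // -!/(h n _).
have [->|n0] := eqVneq n 0; first by rewrite !root_weight0 !mxE !eqxx.
(* If the weights at [n] are constant, [D] contributes nothing at [n], and neither does [M], whose
   entries at a root are differences of these weights. *)
have [|const] := boolP [exists j, exists k, h n j != h n k]; last first.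
  have {}const j k : h n j = h n k.
    apply/eqP; move/existsPn: const => /(_ j)/existsPn/(_ k).
    by rewrite negbK.
  rewrite (const _ ord0) subrr.
  have w0 j : root_weight M n j = 0.
    apply/eqP; apply: contraT => /root_weight_neq0[k]; rewrite mxE.
    have [->|kj] := eqVneq k j => [_|nz nE].
      by rewrite root_eq0 => nE; rewrite nE eqxx in n0.
    by move: nz; rewrite -nE (const _ j) subrr eqxx.
  by rewrite !w0 subrr.
move=> /existsP[p /existsP[q hpq]].
have [a [b [ab nE off_b]]] := root_of_weights
  (fun j k => @extends_to_P_weight D n j k derD extD) n0 (ex_intro _ p (ex_intro _ q hpq)).
(* The weights of [M] at [n] agree with those of [D] up to the constant [h n a], which drops out of
   differences. *)
have w j : root_weight M n j = h n j - h n a.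
  rewrite nE root_weight_root // mxE (negPf ab) -nE.
  have [->|jb] := eqVneq j b; first by rewrite mulr1n.
  by rewrite mulr0n /h (off_b j jb) subrr.
by rewrite !w opprB addrA subrK.
Qed.

(** Among the factors of Z_i D_j only D_j lowers an exponent, and it does so with a coefficient that
    vanishes when that exponent is 0. A non-negative exponent therefore stays non-negative. *)
Lemma restrict_vf_extends M : extends_to_P (restrict_vf M).
Proof.
move=> k f freg n; have linR := (derivation_restrict_vf M).1.
have -> : restrict_vf M f = linext (fun m => restrict_vf M (lmon m)) f.
  apply: (laurent_linear_ext (G := linext (fun m => restrict_vf M (lmon m)))) => //.
    exact: linearP.
  by move=> m; apply/esym/linextU.
move=> /msupp_linext[m mf]; rewrite restrict_vfU => /msupp_sum[i _] /msupp_sum[j _].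
rewrite -mcoeff_neq0 mcoeffZ mcoeff_lmon !mulf_eq0 !negb_or.
move=> /andP[/andP[_ mj] /bool_natr_neq0/eqP<-] l lk.
have := freg m mf l lk; rewrite root_embedD root_embed_root mxE expoBE.
have [jl|jl] := eqVneq j l; last by move=> ml; rewrite subr0 addr_ge0 ?ler0n.
have : root_embed m 0 l != 0 by apply: contraNneq mj => ml; rewrite jl ml.
by move: (root_embed m 0 l) => x; case: (i == l) => /=; lia.
Qed.

End Extension.

(** * Cartan subalgebra and grading *)

Section ThetaSpan.
Variables (K : fieldType) (r : nat).
Implicit Types (c : 'I_r -> K).

Lemma mem_msupp_shmon (n : 'rV[int]_r) (I : {set 'I_r}) a :
  a \in msupp (shmon K n I) -> a = (n, I).
Proof. by rewrite msuppU oner_eq0 inE => /eqP. Qed.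

Lemma theta_span_support c a : a \in msupp (\sum_i c i *: theta K i) ->
  a.1 = 0 /\ #|a.2| = 1%N.
Proof.
by move=> /msupp_sum[i _ /msupp_scale/mem_msupp_shmon->]; rewrite cards1.
Qed.

Lemma mcoeff_theta_span c (n : 'rV[int]_r) (i : 'I_r) :
  (\sum_i c i *: theta K i)@_(n, [set i]) = c i *+ (n == 0).
Proof.
transitivity (\sum_j c j * ((0 == n) && ([set j] == [set i]))%:R).
  by rewrite raddf_sum; apply: eq_bigr => j _; rewrite /= mcoeffZ mcoeffU.
rewrite (bigD1 i) //= eqxx andbT eq_sym mulr_natr big1 ?addr0 // => j ji.
by rewrite (inj_eq set1_inj) (negPf ji) andbF mulr0.
Qed.

Lemma theta_span_ext c (x : SH K r) : sh_degree 1 x ->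
  (forall n i, x@_(n, [set i]) = c i *+ (n == 0)) -> x = \sum_i c i *: theta K i.
Proof.
move=> dx xc; apply: degree1_ext => // [a /theta_span_support[]//|n i].
by rewrite xc mcoeff_theta_span.
Qed.

Lemma canonical_map_image (x : SH K r) :
  (exists c : 'rV[K]_r, x = \sum_(i < r) c 0 i *: theta K i) <->
  (exists2 c : {malg K[{set 'I_r}]}, coh_degree 1 c & canonical_map c = x).
Proof.
split=> [[c ->]|[c dc <-]].
  exists (\sum_i c 0 i *: << [set i] >>).
    move=> I /msupp_sum[i _ /msupp_scale].
    by rewrite msuppU oner_eq0 inE => /eqP->; rewrite cards1.
  rewrite /canonical_map linear_sum; apply: eq_bigr => i _.
  by rewrite linearZ /= linextU.
exists (\row_i c@_[set i]).
have -> : \sum_i (\row_i c@_[set i]) 0 i *: theta K i = \sum_i c@_[set i] *: theta K i.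
  by apply: eq_bigr => i _; rewrite mxE.
apply: (theta_span_ext (c := fun i => c@_[set i])) => [a|n i].
  by move=> /msupp_linext[I Ic /mem_msupp_shmon->]; apply: dc.
have [->|n0] := eqVneq n 0.
  exact: (mcoeff_linext_inj c [set i] (h := fun I => (0 : 'rV[int]_r, I))
    (fun _ _ e => congr1 snd e)).
apply: (mcoeff_linext_out c (h := fun I => (0 : 'rV[int]_r, I))) => I.
by rewrite xpair_eqE eq_sym (negPf n0).
Qed.

End ThetaSpan.

(** * Traceless representatives, the Cartan subalgebra and root degrees in characteristic zero *)

Section Cartan.
Variables (K : fieldType) (charK : [pchar K] =i pred0) (r : nat).
Implicit Types (A B : 'M[K]_r.+1).

Let natK (n : nat) : (n%:R == 0 :> K) = (n == 0%N).
Proof. exact: (pcharf0P K).1. Qed.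

Lemma tr_sl_class A : in_sl (sl_class A).
Proof.
have divK (x : K) : (x / r.+1%:R) *+ r.+1 = x by rewrite -mulr_natr divfK ?natK.
by rewrite /in_sl raddfB /= mxtrace_scalar divK subrr.
Qed.

Lemma sl_class_id A : in_sl A -> sl_class A = A.
Proof. by rewrite /in_sl /sl_class => ->; rewrite mul0r raddf0 subr0. Qed.

Lemma in_sl_scalar c : in_sl (c%:M : 'M[K]_r.+1) -> c = 0.
Proof.
move=> /eqP; rewrite mxtrace_scalar -mulr_natr mulf_eq0 natK orbF.
by move/eqP.
Qed.

(** By linearity of [sl_class], a combination of the classes of the Z_i D_i is the class of a
    diagonal matrix, and a traceless matrix is its own class. *)
Lemma diag_classesP A :
  diag_classes A <-> (forall i j, i != j -> A i j = 0) /\ in_sl A.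
Proof.
have sumE (c : 'rV[K]_r.+1) : \sum_(i < r.+1) c 0 i *: sl_class (delta_mx i i) =
    sl_class (diag_mx c).
  have lin : diag_mx c = \sum_(i < r.+1) c 0 i *: delta_mx i i.
    by rewrite diag_mx_sum_delta.
  rewrite /sl_class lin; under eq_bigr => i _ do rewrite scalerBr.
  rewrite sumrB; congr (_ - _); rewrite raddf_sum mulr_suml raddf_sum.
  by apply: eq_bigr => i _; rewrite /= mxtraceZ -mulrA scale_scalar_mx.
split=> [[c ->]|[Adiag Asl]].
  rewrite sumE; split=> [i j ij|]; last exact: tr_sl_class.
  by rewrite !mxE (negPf ij) !mulr0n subr0.
exists (\row_i A i i); rewrite sumE -[LHS]sl_class_id //; congr sl_class.
apply/matrixP => i j; rewrite !mxE; case: (eqVneq i j) => [->|ij] //.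
exact: Adiag.
Qed.

Lemma mx_bracketE A B i j :
  mx_bracket A B i j = \sum_k A i k * B k j - \sum_k B i k * A k j.
Proof. by rewrite mxE [X in _ + X]mxE !mxE. Qed.

Lemma mx_bracket_diag A B : (forall i j, i != j -> B i j = 0) ->
  forall i j, mx_bracket A B i j = A i j * (B j j - B i i).
Proof.
move=> Bdiag i j; rewrite mx_bracketE (bigD1 j) //= [X in _ - X](bigD1 i) //=.
rewrite !big1 => [|k ki|k kj]; last 2 first.
- by rewrite Bdiag ?mul0r // eq_sym.
- by rewrite Bdiag ?mulr0.
by rewrite !addr0 mulrBr [B i i * _]mulrC.
Qed.

Lemma cartan_diag_classes : cartan_subalgebra (@in_sl K r.+1) (@diag_classes K r.+1).
Proof.
have brac0 A B : diag_classes A -> diag_classes B -> mx_bracket A B = 0.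
  move=> /diag_classesP[dA _] /diag_classesP[dB _]; apply/matrixP => i j.
  rewrite mx_bracket_diag // mxE; case: (eqVneq i j) => [->|ij].
    by rewrite subrr mulr0.
  by rewrite dA // mul0r.
have diag0 : diag_classes (0 : 'M[K]_r.+1).
  by apply/diag_classesP; split=> [i j _|]; rewrite ?mxE // /in_sl raddf0.
split=> [A|||| A slA norm].
- by case/diag_classesP.
- split=> // a A B /diag_classesP[dA tA] /diag_classesP[dB tB].
  apply/diag_classesP; split=> [i j ij|]; first by rewrite !mxE dA // dB // mulr0 addr0.
  by rewrite /in_sl mxtraceD mxtraceZ tA tB mulr0 addr0.
- by move=> A B dA dB; rewrite brac0.
(* Diagonal matrices commute, so a single bracket already vanishes. *)
- exists 1%N => A [|B [|C s]] //= dA ds _; apply: brac0 => //.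
  by apply: ds; rewrite mem_head.
apply/diag_classesP; split=> // i j ij.
(* With this [B] the entry (i, j) of the bracket is twice [A i j], and 2 is invertible. *)
pose B : 'M[K]_r.+1 := delta_mx j j - delta_mx i i.
have dB : diag_classes B.
  apply/diag_classesP; split=> [k l kl|]; last first.
    have tr1 (p : 'I_r.+1) : \tr (delta_mx p p : 'M[K]_r.+1) = 1.
      rewrite /mxtrace (bigD1 p) //= mxE !eqxx big1 ?addr0 // => q qp.
      by rewrite mxE (negPf qp).
    by rewrite /in_sl raddfB /= !tr1 subrr.
  rewrite !mxE.
  have z (p : 'I_r.+1) : (k == p) && (l == p) = false.
    by apply: contraNF kl => /andP[/eqP-> /eqP->].
  by rewrite !z subrr.
have /diag_classesP[/(_ i j ij)] := norm B dB.
rewrite mx_bracket_diag; last by case/diag_classesP: dB.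
rewrite !mxE !eqxx (negPf ij) eq_sym (negPf ij) /= subr0 sub0r opprK => /eqP.
by rewrite -natrD mulf_eq0 natK orbF => /eqP.
Qed.

(** Matrices with the same restriction differ by a scalar, and in characteristic zero a traceless
    scalar matrix is zero. *)
Lemma sl_to_SH_inj A B : in_sl A -> in_sl B -> sl_to_SH A = sl_to_SH B -> A = B.
Proof.
move=> slA slB AB.
have /restrict_vf_eq[c ABc] :=
  sh_of_vf_inj (derivation_restrict_vf A) (derivation_restrict_vf B) AB.
have c0 : c = 0 by apply: in_sl_scalar; rewrite -ABc /in_sl raddfB /= slA slB subrr.
by apply/eqP; rewrite -subr_eq0 ABc c0 raddf0.
Qed.

Lemma sl_to_SH_diag A : (forall i j, i != j -> A i j = 0) ->
  sl_to_SH A = \sum_(i < r) (A (lift ord0 i) (lift ord0 i) - A 0 0) *: theta K i.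
Proof.
move=> dA; pose c (i : 'I_r) := A (lift ord0 i) (lift ord0 i) - A 0 0.
apply: (theta_span_ext (c := c)) => [|n i]; first exact: sl_to_SH_degree1.
rewrite mcoeff_sl_to_SH /c; have [->|n0] := eqVneq n 0; first by rewrite !root_weight0.
have w0 j : root_weight A n j = 0.
  apply/eqP; apply: contraT => /root_weight_neq0[k]; have [->|kj] := eqVneq k j.
    by rewrite root_eq0 => _ nE; rewrite nE eqxx in n0.
  by rewrite dA ?eqxx.
by rewrite !w0 subrr.
Qed.

Lemma sl_to_SH_cartan (x : SH K r) :
  (exists2 A : 'M[K]_r.+1, diag_classes A & sl_to_SH A = x) <->
  (exists c : 'rV[K]_r, x = \sum_(i < r) c 0 i *: theta K i).
Proof.
split=> [[A /diag_classesP[dA _] <-]|[c ->]].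
  exists (\row_i (A (lift ord0 i) (lift ord0 i) - A 0 0)).
  apply: etrans (sl_to_SH_diag dA) _; apply: eq_bigr => i _.
  by rewrite mxE.
(* With entry 0 at the index 0, the differences in [sl_to_SH_diag] are exactly the [c 0 i]. *)
pose d : 'rV[K]_r.+1 := \row_j (if unlift ord0 j is Some i then c 0 i else 0).
have dE i j : i != j -> diag_mx d i j = 0 by move=> ij; rewrite mxE (negPf ij).
exists (sl_class (diag_mx d)).
  apply/diag_classesP; split=> [i j ij|]; last exact: tr_sl_class.
  by rewrite !mxE (negPf ij) !mulr0n subr0.
apply: etrans (sl_to_SH_class _) _; apply: etrans (sl_to_SH_diag dE) _.
have dB (i : 'I_r) : diag_mx d (lift ord0 i) (lift ord0 i) - diag_mx d 0 0 = c 0 i.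
  by rewrite !mxE !eqxx liftK unlift_none !mulr1n subr0.
by apply: eq_bigr => i _; rewrite dB.
Qed.

Lemma sl_to_SH_delta_support (i j : 'I_r.+1) :
  sh_homogeneous (expo i - expo j)
    (sl_to_SH (sl_class (delta_mx i j : 'M[K]_r.+1))).
Proof.
move=> a; rewrite sl_to_SH_class => /sl_to_SH_support[k [l [nz ->]]].
rewrite root_embed_root; move: nz; rewrite mxE => /bool_natr_neq0.
by move=> /andP[/eqP-> /eqP->].
Qed.

(** Injectivity applies because the class has entry 1 at (i, j). This shows that every root actually
    occurs as a degree. *)
Lemma sl_to_SH_delta_neq0 (i j : 'I_r.+1) : i != j ->
  exists a, a \in msupp (sl_to_SH (sl_class (delta_mx i j : 'M[K]_r.+1))).
Proof.
move=> ij; set A := sl_class _.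
have [s0|/fset0Pn//] := eqVneq (msupp (sl_to_SH A)) fset0.
have sA0 : sl_to_SH A = 0 by apply/malgP => a; rewrite mcoeff0 mcoeff_outdom // s0 inE.
have s00 : sl_to_SH (0 : 'M[K]_r.+1) = 0.
  have := sl_to_SH_linear (-1) (0 : 'M[K]_r.+1) 0.
  by rewrite scaler0 addr0 scaleN1r addNr.
have A0 : A = 0.
  apply: sl_to_SH_inj; [exact: tr_sl_class|by rewrite /in_sl raddf0|].
  by rewrite sA0 s00.
have /eqP : A i j = 0 by rewrite A0 mxE.
by rewrite !mxE !eqxx (negPf ij) mulr0n subr0 oner_eq0.
Qed.

End Cartan.

Theorem mainTheorem5 (K : fieldType) (charK : [pchar K] =i pred0)
    (r : nat) (r_gt0 : (0 < r)%N) :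
  (* the isomorphism of Lie algebras Vect(G_m^r) -> SH^1(U) *)
  [/\ forall (n : 'rV[int]_r) (i : 'I_r),
        sh_of_vf (fun f : laurent K r => lmon n * (lvar i * lpartial i f))
          = shmon K n [set i],
      forall (a : K) (D E : laurent K r -> laurent K r),
        derivation D -> derivation E ->
        sh_of_vf (fun f => a *: D f + E f) = a *: sh_of_vf D + sh_of_vf E,
      forall D E : laurent K r -> laurent K r,
        derivation D -> derivation E ->
        sh_of_vf (vf_bracket D E) = sh_bracket (sh_of_vf D) (sh_of_vf E),
      forall D : laurent K r -> laurent K r,
        derivation D -> sh_degree 1 (sh_of_vf D)
    & forall x : SH K r, sh_degree 1 x ->
        exists2 D, derivation D /\ sh_of_vf D = x
          & forall E, derivation E -> sh_of_vf E = x -> E =1 D]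
  /\
  (* restriction of vector fields from P^r, on gl_(r+1) / scalars = sl_(r+1) *)
  [/\ forall A : 'M[K]_r.+1, derivation (restrict_vf A),
      forall A B : 'M[K]_r.+1,
        restrict_vf A =1 restrict_vf B <-> exists c : K, A - B = c%:M
    & forall A : 'M[K]_r.+1,
        in_sl (sl_class A) /\ restrict_vf (sl_class A) =1 restrict_vf A]
  /\
  (* the composition is an embedding of Lie algebras sl_(r+1) -> SH^1(U) *)
  [/\ forall A : 'M[K]_r.+1, in_sl A -> sh_degree 1 (sl_to_SH A),
      forall (a : K) (A B : 'M[K]_r.+1), in_sl A -> in_sl B ->
        sl_to_SH (a *: A + B) = a *: sl_to_SH A + sl_to_SH B,
      forall A B : 'M[K]_r.+1, in_sl A -> in_sl B ->
        sl_to_SH (mx_bracket A B) = sh_bracket (sl_to_SH A) (sl_to_SH B)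
    & forall A B : 'M[K]_r.+1, in_sl A -> in_sl B ->
        sl_to_SH A = sl_to_SH B -> A = B]
  /\
  (* its image *)
  (forall x : SH K r, sh_degree 1 x ->
     (exists2 A : 'M[K]_r.+1, in_sl A & sl_to_SH A = x) <->
     (exists2 D, derivation D /\ extends_to_P D & sh_of_vf D = x))
  /\
  (* the Cartan subalgebra *)
  [/\ cartan_subalgebra (@in_sl K r.+1) (@diag_classes K r.+1),
      forall x : SH K r,
        (exists2 A : 'M[K]_r.+1, diag_classes A & sl_to_SH A = x) <->
        (exists c : 'rV[K]_r, x = \sum_(i < r) c 0 i *: theta K i)
    & forall x : SH K r,
        (exists c : 'rV[K]_r, x = \sum_(i < r) c 0 i *: theta K i) <->
        (exists2 c : {malg K[{set 'I_r}]},
           coh_degree 1 c & canonical_map c = x)]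
  /\
  (* the grading by H_1(U; Z) *)
  [/\ forall A : 'M[K]_r.+1, diag_classes A -> sh_homogeneous 0 (sl_to_SH A),
      forall i j : 'I_r.+1, i != j ->
        sh_homogeneous (expo i - expo j)
          (sl_to_SH (sl_class (delta_mx i j : 'M[K]_r.+1)))
    & forall d : 'rV[int]_r.+1,
        (d != 0 /\
         exists2 A : 'M[K]_r.+1, in_sl A
           & exists2 a, a \in msupp (sl_to_SH A) & root_embed a.1 = d) <->
        (exists a b : 'I_r.+1, a != b /\ d = expo a - expo b)].
Proof.
split; first split.
- by move=> n i; apply: sh_of_vf_monomial.
- by move=> a D E _ _; apply: sh_of_vf_linear.
- exact: sh_of_vf_bracket.
- by move=> D _; apply: sh_of_fun_degree1.
- move=> x /sh_of_vf_surj[D derD Dx]; exists D => // E derE Ex.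
  by apply: (sh_of_vf_inj derE derD); rewrite Ex Dx.
split; first split.
- exact: derivation_restrict_vf.
- exact: restrict_vf_eq.
- by move=> A; split; [apply: tr_sl_class|apply: sl_class_restrict].
split; first split.
- by move=> A _; apply: sl_to_SH_degree1.
- by move=> a A B _ _; apply: sl_to_SH_linear.
- by move=> A B _ _; apply: sl_to_SH_bracket.
- exact: sl_to_SH_inj.
split.
  move=> x _; split=> [[A slA <-]|[D [derD extD] <-]].
    exists (restrict_vf A) => //.
    by split; [apply: derivation_restrict_vf|apply: restrict_vf_extends].
  have [A DA] := extends_to_P_restrict derD extD.
  (* The traceless representative restricts to the same field. *)
  exists (sl_class A); first exact: tr_sl_class.
  apply: etrans (sl_to_SH_class A) _.
  by apply: eq_sh_of_vf => i; rewrite DA.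
split; first split.
- exact: cartan_diag_classes.
- exact: sl_to_SH_cartan.
- exact: canonical_map_image.
split.
- move=> A /diag_classesP[//|dA _] a; rewrite sl_to_SH_diag //.
  move=> /theta_span_support[-> _]; exact: root_embed0.
- by move=> i j _; apply: sl_to_SH_delta_support.
- move=> d; split=> [[d0 [A slA [a aA ad]]]|[a [b [ab ->]]]].
    (* Diagonal entries contribute only in degree zero, so [d != 0] forces [i != j]. *)
    have [i [j [_ aij]]] := sl_to_SH_support aA.
    exists i, j; rewrite -ad aij root_embed_root; split=> //.
    by apply: contraNneq d0 => ij; rewrite -ad aij root_embed_root ij subrr.
  split.
    by rewrite -root_embed_root -root_embed0 (inj_eq (@root_embed_inj r)) root_neq0.
  exists (sl_class (delta_mx a b)); first exact: tr_sl_class.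
  have [c cA] := sl_to_SH_delta_neq0 charK ab.
  by exists c => //; apply: sl_to_SH_delta_support cA.
Qed.
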